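(* Let $V$ be the first fundamental $U_{r,s}(\mathfrak{so}_{2n+1})$-module with basis $v_1,\dots,v_{2n+1}$ described in the context. The $U_{r,s}(\mathfrak{so}_{2n+1})$-module isomorphism $\hat R_{VV}=\Theta\circ\widetilde f\circ\tau\colon V\otimes V\to V\otimes V$ coincides with the operator $$\begin{aligned}\hat R={}& r^{-1}s\sum_{1\le i\le 2n+1,\ i\ne n+1}E_{ii}\otimes E_{ii}+E_{n+1,n+1}\otimes E_{n+1,n+1}+rs^{-1}\sum_{1\le i\le 2n+1,\ i\neq n+1}E_{ii'}\otimes E_{i'i}\\&+\sum_{1\le i,j\le 2n+1,\ j\ne i,i'}a_{ij}E_{ij}\otimes E_{ji}+(r^2-s^2)(rs)^{-1}\sum_{i=1}^n\bigl(r^{2(n-i)+1}s^{2(i-n)-1}-1\bigr)E_{i'i'}\otimes E_{ii}\\&+(s^2-r^2)(rs)^{-1}\sum_{i>j,\ j\ne i'}E_{ii}\otimes E_{jj}+(r^2-s^2)(rs)^{-1}\sum_{i<j,\ j\neq i'}t_it_j^{-1}E_{i'j}\otimes E_{ij'},\end{aligned}$$ where $t_i=s^{2(i-n)-1}$ if $i<n+1$, $t_{n+1}=s^{-1}$, $t_i=r^{2(n+1-i)+1}$ if $i>n+1$; $\sigma_i=-1,0,1$ if $i<n+1$, $i=n+1$, $i>n+1$ respectively; and $a_{ij}=(rs)^{-\sigma_i\sigma_j}$ if ($i<j$ and $i<j'$) or ($i>j$ and $i>j'$), while $a_{ij}=(rs)^{\sigma_i\sigma_j}$ if $j<i<j'$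 or $j'<i<j$.
   Context: $\mathbb K$ is an algebraically closed field containing $\mathbb C(r,s)$ with $r,s$ indeterminates. **Root data (type $B_n$).** $\varepsilon_1,\dots,\varepsilon_n$ is an orthogonal basis of $\mathbb R^n$ with $(\varepsilon_i,\varepsilon_i)=2$; $\alpha_i=\varepsilon_i-\varepsilon_{i+1}$ ($i<n$), $\alpha_n=\varepsilon_n$; $Q=\bigoplus\mathbb Z\alpha_i$. $c_{ij}=2(\alpha_i,\alpha_j)/(\alpha_i,\alpha_i)$, $d_i=(\alpha_i,\alpha_i)/2$, $r_i=r^{d_i}$, $s_i=s^{d_i}$. $\langle\cdot,\cdot\rangle$ is the bilinear form on $Q=\bigoplus\mathbb Z\varepsilon_i$ with $\langle\varepsilon_i,\varepsilon_i\rangle=1$, $\langle\varepsilon_i,\varepsilon_j\rangle=-1$ for $i<j$ and $=1$ for $i>j$; equivalently $\langle\alpha_i,\alpha_j\rangle=d_ic_{ij}$ if $i<j$, $d_i$ if $i=j$, $0$ if $i>j$. **Algebra.** $[m]_{r,s}=\frac{r^m-s^m}{r-s}$, $[m]_{r,s}!=[m]_{r,s}\cdots[1]_{r,s}$, $\genfrac{[}{]}{0pt}{}{m}{k}_{r,s}=\frac{[m]_{r,s}!}{[m-k]_{r,s}![k]_{r,s}!}$. $U_{r,s}=U_{r,s}(\mathfrak{so}_{2n+1})$ is the associative $\mathbb K$-algebra generated by $e_i,f_i,\omega_i^{\pm1},(\omega_i')^{\pm1}$ ($1\le i\le n$) with relations: all $\omega_i^{\pm1},(\omega'_j)^{\pm1}$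 commute and $\omega_i\omega_i^{-1}=1=\omega_i'(\omega_i')^{-1}$; $\omega_ie_j=r^{\langle\alpha_j,\alpha_i\rangle}s^{-\langle\alpha_i,\alpha_j\rangle}e_j\omega_i$, $\omega_if_j=r^{-\langle\alpha_j,\alpha_i\rangle}s^{\langle\alpha_i,\alpha_j\rangle}f_j\omega_i$, $\omega_i'e_j=r^{-\langle\alpha_i,\alpha_j\rangle}s^{\langle\alpha_j,\alpha_i\rangle}e_j\omega_i'$, $\omega_i'f_j=r^{\langle\alpha_i,\alpha_j\rangle}s^{-\langle\alpha_j,\alpha_i\rangle}f_j\omega_i'$; $e_if_j-f_je_i=\delta_{ij}\frac{\omega_i-\omega_i'}{r_i-s_i}$; and for $i\ne j$, $\sum_{k=0}^{1-c_{ij}}(-1)^k\genfrac{[}{]}{0pt}{}{1-c_{ij}}{k}_{r_i,s_i}(r_is_i)^{k(k-1)/2}(rs)^{k\langle\alpha_j,\alpha_i\rangle}e_i^{1-c_{ij}-k}e_je_i^k=0$ and the same with $e_i^{1-c_{ij}-k}e_je_i^k$ replaced by $f_i^kf_jf_i^{1-c_{ij}-k}$. Coproduct: $\omega_i,\omega_i'$ are group-like, $\Delta(e_i)=e_i\otimes1+\omega_i\otimes e_i$, $\Delta(f_i)=1\otimes f_i+f_i\otimes\omega_i'$. For $\mu=\sum k_i\alpha_i$: $\omega_\mu=\prod\omega_i^{k_i}$, $\omega'_\mu=\prod(\omega'_i)^{k_i}$. $U^+$, $U^-$ are the subalgebras generated by the $e_i$, resp. the $f_i$; $U^{\ge}$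 by the $e_i,\omega_i^{\pm1}$; $U^{\le}$ by the $f_i,(\omega_i')^{\pm1}$; they are $Q$-graded with $\deg e_i=\alpha_i=-\deg f_i$, $\deg \omega_i=\deg\omega_i'=0$. **Pairing, $\Theta$, $\widetilde f$.** $(\cdot,\cdot)\colon U^{\le}\times U^{\ge}\to\mathbb K$ is the unique bilinear pairing with $(yy',x)=(y\otimes y',\Delta(x))$, $(y,xx')=(\Delta(y),x'\otimes x)$, $(f_i,\omega_j)=0=(\omega_i',e_j)$, $(f_i,e_j)=\delta_{ij}/(s_i-r_i)$, $(\omega'_\lambda,\omega_\mu)=r^{\langle\lambda,\mu\rangle}s^{-\langle\mu,\lambda\rangle}$. For $\mu>0$ in $Q$ let $\{x_i^\mu\}$, $\{y_i^\mu\}$ be dual bases of $U^+_\mu$, $U^-_{-\mu}$, $\Theta_\mu=\sum_iy_i^\mu\otimes x_i^\mu$, $\Theta=1+\sum_{\mu>0}\Theta_\mu$ (acting on a tensor product of finite-dimensional modules by a finite sum). A vector $v$ has weight $\lambda$ if $\omega_iv=(\omega'_\lambda,\omega_i)v$ and $\omega'_iv=(\omega'_i,\omega_\lambda)^{-1}v$ for all $i$. $\widetilde f(v\otimes w)=f(\lambda,\mu)\,v\otimes w$ for $v,w$ of weights $\lambda,\mu$, where $f(\lambda,\mu)=(\omega'_\mu,\omega_\lambda)^{-1}=r^{-\langle\mu,\lambda\rangle}s^{\langle\lambda,\mu\rangle}$. $\tau(v\otimes w)=w\otimes v$. **Module.** $N=2n+1$, $i'=N+1-i$, $V=\mathbb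 K^{N}$ with basis $v_1,\dots,v_N$ and matrix units $E_{ij}v_k=\delta_{jk}v_i$. $v_k$ has weight $\varepsilon_k$, where $\varepsilon_{n+1}=0$ and $\varepsilon_{k'}=-\varepsilon_k$ for $k\le n$ (this determines the action of $\omega_i,\omega_i'$); $e_i=E_{i,i+1}-E_{(i+1)',i'}$ for $1\le i\le n$; $f_i=E_{i+1,i}-(rs)^{-2}E_{i',(i+1)'}$ for $i<n$; $f_n=(r^{-1}+s^{-1})(E_{n+1,n}-E_{n',n+1})$. In all sums indices run over $1,\dots,2n+1$ unless otherwise indicated. *)

(* Defs.v *)
From HB Require Import structures.
From mathcomp Require Import all_boot all_order all_algebra.
From mathcomp Require Import boolp classical_sets functions cardinality fsbigop.
From mathcomp Require Import reals complex mxtens.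

Set Implicit Arguments.
Unset Strict Implicit.
Unset Printing Implicit Defensive.

Import Order.TTheory GRing.Theory Num.Theory.
Local Open Scope quotient_scope.
Local Open Scope ring_scope.

(* The tensor product A (x) B of two algebras: finite formal sums of pairs,   *)
(* two sums being identified when every bilinear map from A * B to a          *)
(* K-module takes the same value on both (the universal property of the       *)
(* tensor product).                                                           *)
Section Tensor.
Variables (K : fieldType) (A B : algType K).

Definition tsum (W : lmodType K) (b : A -> B -> W) (s : seq (A * B)) : W :=
  \sum_(p <- s) b p.1 p.2.

Definition tensor_eqv (s t : seq (A * B)) : Prop :=
  forall (W : lmodType K) (b : A -> B -> W),
    bilinear_for *:%R *:%R b -> tsum b s = tsum b t.

Definition tensor_rel (s t : seq (A * B)) : bool := `[< tensor_eqv s t >].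

Fact tensor_rel_is_equiv : equiv_class_of tensor_rel.
Proof.
split=> [s|s t|t s u]; first by apply/asboolP.
  by apply/asboolP/asboolP => H W b bb; rewrite H.
by move=> /asboolP H1 /asboolP H2; apply/asboolP => W b bb; rewrite H1 ?H2.
Qed.
Canonical tensor_equiv := EquivRelPack tensor_rel_is_equiv.

Definition tensor : Type := {eq_quot tensor_equiv}.
HB.instance Definition _ := Choice.on tensor.

(* The linear map out of A (x) B induced by a bilinear map.                   *)
Definition tlift (W : lmodType K) (b : A -> B -> W) (x : tensor) : W :=
  tsum b (repr x).

Lemma tlift_pi (W : lmodType K) (b : A -> B -> W) s :
  bilinear_for *:%R *:%R b -> tlift b (\pi_{eq_quot tensor_equiv} s) = tsum b s.
Proof.
move=> bb; have /eqmodP/asboolP : repr (\pi_{eq_quot tensor_equiv} s) = s %[mod {eq_quot tensor_equiv}].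
  by rewrite reprK.
exact.
Qed.

Lemma tensor_ext (x y : tensor) :
  (forall (W : lmodType K) (b : A -> B -> W),
     bilinear_for *:%R *:%R b -> tlift b x = tlift b y) -> x = y.
Proof.
move=> H; rewrite -[x]reprK -[y]reprK; apply/eqmodP/asboolP => W b bb.
exact: H.
Qed.

Definition tens (a : A) (b : B) : tensor := \pi_{eq_quot tensor_equiv} [:: (a, b)].

Definition tadd (x y : tensor) : tensor := \pi_{eq_quot tensor_equiv} (repr x ++ repr y).
Definition tscale (c : K) (x : tensor) : tensor :=
  \pi_{eq_quot tensor_equiv} [seq (c *: p.1, p.2) | p <- repr x].
Definition tmul (x y : tensor) : tensor :=
  \pi_{eq_quot tensor_equiv} [seq (p.1 * q.1, p.2 * q.2) | p <- repr x, q <- repr y].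
Definition tzero : tensor := \pi_{eq_quot tensor_equiv} [::].
Definition topp (x : tensor) : tensor := tscale (- 1) x.
Definition tone : tensor := tens 1 1.

Section Lift.
Variables (W : lmodType K) (b : A -> B -> W).
Hypothesis bb : bilinear_for *:%R *:%R b.

Lemma tlift_zero : tlift b tzero = 0.
Proof. by rewrite tlift_pi // /tsum big_nil. Qed.

Lemma tlift_tens x y : tlift b (tens x y) = b x y.
Proof. by rewrite tlift_pi // /tsum big_seq1. Qed.

Lemma tlift_add x y : tlift b (tadd x y) = tlift b x + tlift b y.
Proof. by rewrite tlift_pi // /tsum big_cat. Qed.

Lemma tlift_scale c x : tlift b (tscale c x) = c *: tlift b x.
Proof.
rewrite tlift_pi // /tsum big_map scaler_sumr; apply: eq_bigr => p _ /=.
exact: (scalable_linear (bb.1 p.2)).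
Qed.

Lemma tlift_opp x : tlift b (topp x) = - tlift b x.
Proof. by rewrite tlift_scale scaleN1r. Qed.

Lemma tlift_mul x y :
  tlift b (tmul x y) =
  tlift (fun a a' => tlift (fun d d' => b (a * d) (a' * d')) y) x.
Proof.
by rewrite tlift_pi // /tsum big_allpairs_dep; apply: eq_bigr => p _.
Qed.

Lemma bilin_mull (d : A) (d' : B) :
  bilinear_for *:%R *:%R (fun a a' => b (a * d) (a' * d')).
Proof.
split=> [a' c x y|a c x y] /=.
  by rewrite mulrDl -scalerAl (bb.1 (a' * d')).
by rewrite mulrDl -scalerAl (bb.2 (a * d)).
Qed.

Lemma bilin_mulr (a : A) (a' : B) :
  bilinear_for *:%R *:%R (fun d d' => b (a * d) (a' * d')).
Proof.
split=> [d' c x y|d c x y] /=.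
  by rewrite mulrDr -scalerAr (bb.1 (a' * d')).
by rewrite mulrDr -scalerAr (bb.2 (a * d)).
Qed.

Lemma bilin_sum (y : tensor) :
  bilinear_for *:%R *:%R
    (fun a a' => tlift (fun d d' => b (a * d) (a' * d')) y).
Proof.
split=> [a' c u v|a c u v] /=; rewrite /tlift /tsum scaler_sumr -big_split /=;
  apply: eq_bigr => q _.
  exact: (bilin_mull q.1 q.2).1.
exact: (bilin_mull q.1 q.2).2.
Qed.

End Lift.

Fact taddA : associative tadd.
Proof. by move=> x y z; apply: tensor_ext => W b bb; rewrite !tlift_add ?addrA. Qed.
Fact taddC : commutative tadd.
Proof. by move=> x y; apply: tensor_ext => W b bb; rewrite !tlift_add // addrC. Qed.
Fact tadd0 : left_id tzero tadd.
Proof.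
by move=> x; apply: tensor_ext => W b bb; rewrite tlift_add // tlift_zero // add0r.
Qed.
Fact taddN : left_inverse tzero topp tadd.
Proof.
move=> x; apply: tensor_ext => W b bb.
by rewrite tlift_add // tlift_opp // tlift_zero // addNr.
Qed.
HB.instance Definition _ := GRing.isZmodule.Build tensor taddA taddC tadd0 taddN.

Fact tscaleA (c d : K) x : tscale c (tscale d x) = tscale (c * d) x.
Proof. by apply: tensor_ext => W b bb; rewrite !tlift_scale // scalerA. Qed.
Fact tscale1 : left_id 1 tscale.
Proof. by move=> x; apply: tensor_ext => W b bb; rewrite tlift_scale // scale1r. Qed.
Fact tscaleDr : right_distributive tscale +%R.
Proof.
move=> c x y; apply: tensor_ext => W b bb.
by rewrite tlift_scale // !tlift_add // !tlift_scale // scalerDr.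
Qed.
Fact tscaleDl x : {morph tscale^~ x : c d / c + d}.
Proof.
move=> c d; apply: tensor_ext => W b bb.
by rewrite tlift_scale // !tlift_add // !tlift_scale // scalerDl.
Qed.
HB.instance Definition _ :=
  GRing.Zmodule_isLmodule.Build K tensor tscaleA tscale1 tscaleDr tscaleDl.

Fact tmulA : associative tmul.
Proof.
move=> x y z; apply: tensor_ext => W b bb.
rewrite !tlift_mul //; last exact: bilin_sum.
rewrite {1}/tlift {1}/tsum [RHS]/tlift [RHS]/tsum; apply: eq_bigr => p _.
rewrite tlift_mul; last exact: bilin_mulr.
rewrite {1}/tlift {1}/tsum [RHS]/tlift [RHS]/tsum; apply: eq_bigr => q _.
by apply: eq_bigr => t _; rewrite !mulrA.
Qed.
Fact tmul1l : left_id tone tmul.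
Proof.
move=> x; apply: tensor_ext => W b bb.
rewrite tlift_mul // tlift_tens; last exact: bilin_sum.
by apply: eq_bigr => q _; rewrite !mul1r.
Qed.
Fact tmul1r : right_id tone tmul.
Proof.
move=> x; apply: tensor_ext => W b bb; rewrite tlift_mul //.
apply: eq_bigr => q _; rewrite tlift_tens ?mulr1 //.
exact: bilin_mulr.
Qed.
Fact tmulDl : left_distributive tmul +%R.
Proof.
move=> x y z; apply: tensor_ext => W b bb.
by rewrite tlift_mul // !tlift_add // ?tlift_mul //; exact: bilin_sum.
Qed.
Fact tmulDr : right_distributive tmul +%R.
Proof.
move=> x y z; apply: tensor_ext => W b bb.
rewrite tlift_mul // !tlift_add // !tlift_mul //.
rewrite /tlift /tsum -big_split; apply: eq_bigr => p _ /=.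
exact: (tlift_add (bilin_mulr bb p.1 p.2)).
Qed.
HB.instance Definition _ := GRing.Zmodule_isPzRing.Build tensor
  tmulA tmul1l tmul1r tmulDl tmulDr.

End Tensor.

(* The lattice Q is represented by the coordinates with respect to the basis  *)
(* eps_1, ..., eps_n; ordinals are 0-based, so i : 'I_n stands for i + 1.     *)
Section RootData.
Variable n : nat.

Definition rlat := 'rV[int]_n.

Definition ip (x y : rlat) : int := 2 * \sum_i x 0 i * y 0 i.

Definition alpha (i : 'I_n) : rlat :=
  \row_j ((j == i)%:Z - (j == i.+1 :> nat)%:Z).

Definition cartan (i j : 'I_n) : int :=
  ((2 * ip (alpha i) (alpha j)) %/ ip (alpha i) (alpha i))%Z.

Definition dd (i : 'I_n) : int := (ip (alpha i) (alpha i) %/ 2)%Z.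

Definition rsform (x y : rlat) : int :=
  \sum_i \sum_j x 0 i * y 0 j * (if (i < j)%N then - 1 else 1).

Definition root_comb (k : 'I_n -> int) : rlat := \sum_i alpha i *~ k i.

Definition rlat_pos (mu : rlat) : Prop :=
  mu != 0 /\ exists k : 'I_n -> nat, mu = root_comb (fun i => (k i)%:Z).

End RootData.

Section QuantumGroup.
Variables (K : fieldType) (r s : K) (n : nat).

Definition qint (p q : K) (m : nat) : K := (p ^+ m - q ^+ m) / (p - q).
Definition qfact (p q : K) (m : nat) : K := \prod_(1 <= k < m.+1) qint p q k.
Definition qbin (p q : K) (m k : nat) : K :=
  qfact p q m / (qfact p q (m - k) * qfact p q k).

Definition rr (i : 'I_n) : K := r ^ dd i.
Definition ss (i : 'I_n) : K := s ^ dd i.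

(* (omega'_lambda, omega_mu) *)
Definition chi (lambda mu : rlat n) : K :=
  r ^ rsform lambda mu * s ^ (- rsform mu lambda).

(* GwV, GwpV stand for the inverses of omega_i, omega'_i.                     *)
Inductive gen : Type :=
  Ge of 'I_n | Gf of 'I_n | Gw of 'I_n | GwV of 'I_n | Gwp of 'I_n | GwpV of 'I_n.

Definition torus (x : gen) : bool :=
  match x with Ge _ | Gf _ => false | _ => true end.

Record U_relations (A : algType K) (g : gen -> A) : Prop := URelations {
  rel_torus : forall x y, torus x -> torus y -> g x * g y = g y * g x;
  rel_w : forall i, g (Gw i) * g (GwV i) = 1;
  rel_wp : forall i, g (Gwp i) * g (GwpV i) = 1;
  rel_we : forall i j, g (Gw i) * g (Ge j) =
    (r ^ rsform (alpha j) (alpha i) * s ^ (- rsform (alpha i) (alpha j)))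
      *: (g (Ge j) * g (Gw i));
  rel_wf : forall i j, g (Gw i) * g (Gf j) =
    (r ^ (- rsform (alpha j) (alpha i)) * s ^ rsform (alpha i) (alpha j))
      *: (g (Gf j) * g (Gw i));
  rel_wpe : forall i j, g (Gwp i) * g (Ge j) =
    (r ^ (- rsform (alpha i) (alpha j)) * s ^ rsform (alpha j) (alpha i))
      *: (g (Ge j) * g (Gwp i));
  rel_wpf : forall i j, g (Gwp i) * g (Gf j) =
    (r ^ rsform (alpha i) (alpha j) * s ^ (- rsform (alpha j) (alpha i)))
      *: (g (Gf j) * g (Gwp i));
  rel_ef : forall i j, g (Ge i) * g (Gf j) - g (Gf j) * g (Ge i) =
    ((i == j)%:R / (rr i - ss i)) *: (g (Gw i) - g (Gwp i));
  rel_serre_e : forall i j : 'I_n, i != j ->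
    let m := `|1 - cartan i j|%N in
    \sum_(k < m.+1)
      ((- 1) ^+ k * qbin (rr i) (ss i) m k * (rr i * ss i) ^+ (k * k.-1 %/ 2)
         * (r * s) ^ (k%:Z * rsform (alpha j) (alpha i)))
      *: (g (Ge i) ^+ (m - k) * g (Ge j) * g (Ge i) ^+ k) = 0;
  rel_serre_f : forall i j : 'I_n, i != j ->
    let m := `|1 - cartan i j|%N in
    \sum_(k < m.+1)
      ((- 1) ^+ k * qbin (rr i) (ss i) m k * (rr i * ss i) ^+ (k * k.-1 %/ 2)
         * (r * s) ^ (k%:Z * rsform (alpha j) (alpha i)))
      *: (g (Gf i) ^+ k * g (Gf j) * g (Gf i) ^+ (m - k)) = 0
}.

(* U_{r,s}(so_{2n+1}): noncommutative polynomial expressions in the           *)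
(* generators, two expressions being identified when they have the same value *)
(* in every K-algebra satisfying the relations. [U_gen_relations] and         *)
(* [U_universal] below show that this is the algebra presented by these       *)
(* generators and relations.                                                  *)
Inductive expr : Type :=
  EConst of K | EGen of gen | EAdd of expr & expr | EMul of expr & expr.
HB.instance Definition _ := gen_eqMixin expr.
HB.instance Definition _ := gen_choiceMixin expr.

Fixpoint eval (A : algType K) (g : gen -> A) (t : expr) : A :=
  match t with
  | EConst c => c%:A
  | EGen x => g x
  | EAdd t u => eval g t + eval g u
  | EMul t u => eval g t * eval g u
  end.

Definition expr_eqv (t u : expr) : Prop :=
  forall (A : algType K) (g : gen -> A), U_relations g -> eval g t = eval g u.
Definition expr_rel (t u : expr) : bool := `[< expr_eqv t u >].

Fact expr_rel_is_equiv : equiv_class_of expr_rel.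
Proof.
split=> [t|t u|t u v]; first by apply/asboolP.
  by apply/asboolP/asboolP => H A g rg; rewrite H.
by move=> /asboolP H1 /asboolP H2; apply/asboolP => A g rg; rewrite H1 ?H2.
Qed.
Canonical expr_equiv := EquivRelPack expr_rel_is_equiv.

Definition U : Type := {eq_quot expr_equiv}.
HB.instance Definition _ := Choice.on U.

Definition piU (t : expr) : U := \pi_{eq_quot expr_equiv} t.

Definition Ueval (A : algType K) (g : gen -> A) (x : U) : A := eval g (repr x).

Lemma Ueval_pi (A : algType K) (g : gen -> A) t :
  U_relations g -> Ueval g (piU t) = eval g t.
Proof.
move=> rg.
have /eqmodP/asboolP : repr (piU t) = t %[mod {eq_quot expr_equiv}].
  by rewrite reprK.
exact.
Qed.

Lemma U_ext (x y : U) :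
  (forall (A : algType K) (g : gen -> A), U_relations g ->
     Ueval g x = Ueval g y) -> x = y.
Proof.
move=> H; rewrite -[x]reprK -[y]reprK; apply/eqmodP/asboolP => A g rg.
exact: H.
Qed.

Definition Uconst (c : K) : U := piU (EConst c).
Definition Ugen (x : gen) : U := piU (EGen x).
Definition Uadd (x y : U) : U := piU (EAdd (repr x) (repr y)).
Definition Umul (x y : U) : U := piU (EMul (repr x) (repr y)).
Definition Uscale (c : K) (x : U) : U := Umul (Uconst c) x.
Definition Uopp (x : U) : U := Uscale (- 1) x.

Section Eval.
Variables (A : algType K) (g : gen -> A).
Hypothesis rg : U_relations g.

Lemma Ueval_const c : Ueval g (Uconst c) = c%:A.
Proof. by rewrite Ueval_pi. Qed.
Lemma Ueval_gen x : Ueval g (Ugen x) = g x.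
Proof. by rewrite Ueval_pi. Qed.
Lemma Ueval_add x y : Ueval g (Uadd x y) = Ueval g x + Ueval g y.
Proof. by rewrite Ueval_pi. Qed.
Lemma Ueval_mul x y : Ueval g (Umul x y) = Ueval g x * Ueval g y.
Proof. by rewrite Ueval_pi. Qed.
Lemma Ueval_scale c x : Ueval g (Uscale c x) = c *: Ueval g x.
Proof. by rewrite Ueval_mul Ueval_const -scalerAl mul1r. Qed.
Lemma Ueval_opp x : Ueval g (Uopp x) = - Ueval g x.
Proof. by rewrite Ueval_scale scaleN1r. Qed.
End Eval.

Definition UevalE :=
  (Ueval_const, Ueval_gen, Ueval_add, Ueval_mul, Ueval_scale, Ueval_opp).

Fact UaddA : associative Uadd.
Proof. by move=> x y z; apply: U_ext => A g rg; rewrite !UevalE ?addrA. Qed.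
Fact UaddC : commutative Uadd.
Proof. by move=> x y; apply: U_ext => A g rg; rewrite !UevalE // addrC. Qed.
Fact Uadd0 : left_id (Uconst 0) Uadd.
Proof. by move=> x; apply: U_ext => A g rg; rewrite !UevalE // scale0r add0r. Qed.
Fact UaddN : left_inverse (Uconst 0) Uopp Uadd.
Proof. by move=> x; apply: U_ext => A g rg; rewrite !UevalE // scale0r addNr. Qed.
HB.instance Definition _ := GRing.isZmodule.Build U UaddA UaddC Uadd0 UaddN.

Fact UmulA : associative Umul.
Proof. by move=> x y z; apply: U_ext => A g rg; rewrite !UevalE ?mulrA. Qed.
Fact Umul1l : left_id (Uconst 1) Umul.
Proof. by move=> x; apply: U_ext => A g rg; rewrite !UevalE // scale1r mul1r. Qed.
Fact Umul1r : right_id (Uconst 1) Umul.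
Proof. by move=> x; apply: U_ext => A g rg; rewrite !UevalE // scale1r mulr1. Qed.
Fact UmulDl : left_distributive Umul +%R.
Proof. by move=> x y z; apply: U_ext => A g rg; rewrite !UevalE // mulrDl. Qed.
Fact UmulDr : right_distributive Umul +%R.
Proof. by move=> x y z; apply: U_ext => A g rg; rewrite !UevalE // mulrDr. Qed.

(* The values of the counit; only used to see that the algebra is not zero.   *)
Definition triv_gen (x : gen) : K^o := if torus x then 1 else 0.
Fact triv_relations : U_relations triv_gen.
Proof.
split; rewrite /triv_gen /=.
- by move=> x y -> ->.
- by move=> i; rewrite mulr1.
- by move=> i; rewrite mulr1.
- by move=> i j; rewrite mul0r mulr0 scaler0.
- by move=> i j; rewrite mul0r mulr0 scaler0.
- by move=> i j; rewrite mul0r mulr0 scaler0.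
- by move=> i j; rewrite mul0r mulr0 scaler0.
- by move=> i j; rewrite mul0r !subrr scaler0.
- by move=> i j _; apply: big1 => k _; rewrite mulr0 mul0r scaler0.
- by move=> i j _; apply: big1 => k _; rewrite mulr0 mul0r scaler0.
Qed.

Fact Uone_neq0 : Uconst 1 != Uconst 0.
Proof.
apply/eqP => /(congr1 (Ueval triv_gen)).
rewrite !(Ueval_const triv_relations) scale0r scale1r => /eqP.
by rewrite oner_eq0.
Qed.

HB.instance Definition _ := GRing.Zmodule_isNzRing.Build U
  UmulA Umul1l Umul1r UmulDl UmulDr Uone_neq0.

Fact UscaleA (c d : K) x : Uscale c (Uscale d x) = Uscale (c * d) x.
Proof. by apply: U_ext => A g rg; rewrite !UevalE // scalerA. Qed.
Fact Uscale1 : left_id 1 Uscale.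
Proof. by move=> x; apply: U_ext => A g rg; rewrite !UevalE // scale1r. Qed.
Fact UscaleDr : right_distributive Uscale +%R.
Proof. by move=> c x y; apply: U_ext => A g rg; rewrite !UevalE // scalerDr. Qed.
Fact UscaleDl x : {morph Uscale^~ x : c d / c + d}.
Proof. by move=> c d; apply: U_ext => A g rg; rewrite !UevalE // scalerDl. Qed.
HB.instance Definition _ :=
  GRing.Zmodule_isLmodule.Build K U UscaleA Uscale1 UscaleDr UscaleDl.

Fact UscaleAl (c : K) (x y : U) : c *: (x * y) = (c *: x) * y.
Proof.
apply: U_ext => A g rg.
rewrite (Ueval_scale rg) (Ueval_mul rg) [RHS](Ueval_mul rg) (Ueval_scale rg).
exact: scalerAl.
Qed.
HB.instance Definition _ := GRing.Lmodule_isLalgebra.Build K U UscaleAl.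
Fact UscaleAr (c : K) (x y : U) : c *: (x * y) = x * (c *: y).
Proof.
apply: U_ext => A g rg.
rewrite (Ueval_scale rg) (Ueval_mul rg) [RHS](Ueval_mul rg) (Ueval_scale rg).
exact: scalerAr.
Qed.
HB.instance Definition _ := GRing.Lalgebra_isAlgebra.Build K U UscaleAr.

Section EvalMorphism.
Variables (A : algType K) (g : gen -> A).
Hypothesis rg : U_relations g.

Lemma Ueval_is_zmod : zmod_morphism (Ueval g : U -> A).
Proof. by move=> x y; rewrite (Ueval_add rg) (Ueval_opp rg). Qed.
Lemma Ueval_is_monoid : monoid_morphism (Ueval g : U -> A).
Proof.
by split=> [|x y]; [rewrite (Ueval_const rg) scale1r | rewrite (Ueval_mul rg)].
Qed.
Lemma Ueval_is_scalable : scalable (Ueval g : U -> A).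
Proof. by move=> c x; rewrite (Ueval_scale rg). Qed.

Definition UevalM : {lrmorphism U -> A} :=
  HB.pack (Ueval g : U -> A)
    (GRing.isZmodMorphism.Build U A (Ueval g) Ueval_is_zmod)
    (GRing.isMonoidMorphism.Build U A (Ueval g) Ueval_is_monoid)
    (GRing.isScalable.Build K U A *:%R (Ueval g) Ueval_is_scalable).
End EvalMorphism.

Lemma U_gen_relations : U_relations (Ugen : gen -> U).
Proof.
have ext (x y : U) : (forall (A : algType K) (g : gen -> A)
    (rg : U_relations g) (h : {lrmorphism U -> A}),
    (forall z, h (Ugen z) = g z) -> h x = h y) -> x = y.
  move=> H; apply: U_ext => A g rg.
  exact: (H A g rg (UevalM rg) (Ueval_gen rg)).
split.
- by move=> x y tx ty; apply: ext => A g rg h hE; rewrite !rmorphM /= !hE (rel_torus rg).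
- by move=> i; apply: ext => A g rg h hE; rewrite rmorphM rmorph1 /= !hE (rel_w rg).
- by move=> i; apply: ext => A g rg h hE; rewrite rmorphM rmorph1 /= !hE (rel_wp rg).
- by move=> i j; apply: ext => A g rg h hE; rewrite linearZ /= !rmorphM /= !hE (rel_we rg).
- by move=> i j; apply: ext => A g rg h hE; rewrite linearZ /= !rmorphM /= !hE (rel_wf rg).
- by move=> i j; apply: ext => A g rg h hE; rewrite linearZ /= !rmorphM /= !hE (rel_wpe rg).
- by move=> i j; apply: ext => A g rg h hE; rewrite linearZ /= !rmorphM /= !hE (rel_wpf rg).
- move=> i j; apply: ext => A g rg h hE.
  by rewrite linearZZ rmorphB !rmorphM /= rmorphB /= !hE (rel_ef rg).
- move=> i j ij; apply: ext => A g rg h hE.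
  rewrite rmorph0 rmorph_sum -[RHS](rel_serre_e rg ij); apply: eq_bigr => k _.
  by rewrite /= linearZZ !rmorphM !rmorphXn /= !hE.
- move=> i j ij; apply: ext => A g rg h hE.
  rewrite rmorph0 rmorph_sum -[RHS](rel_serre_f rg ij); apply: eq_bigr => k _.
  by rewrite /= linearZZ !rmorphM !rmorphXn /= !hE.
Qed.

Lemma U_ind (P : U -> Prop) :
  (forall x, P (Ugen x)) -> (forall c, P c%:A) ->
  (forall x y, P x -> P y -> P (x + y)) ->
  (forall x y, P x -> P y -> P (x * y)) -> forall x, P x.
Proof.
move=> Pg Pc Pa Pm x; rewrite -[x]reprK.
have piM t u : piU (EMul t u) = piU t * piU u.
  by apply: U_ext => A g rg; rewrite (Ueval_mul rg) !Ueval_pi.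
have piD t u : piU (EAdd t u) = piU t + piU u.
  by apply: U_ext => A g rg; rewrite (Ueval_add rg) !Ueval_pi.
have piC c : piU (EConst c) = c%:A.
  apply: U_ext => A g rg.
  by rewrite (Ueval_scale rg) !Ueval_pi //= scale1r.
elim: (repr x) => [c|y|t IHt u IHu|t IHt u IHu].
- by have := Pc c; rewrite -piC.
- exact: Pg.
- by have := Pa _ _ IHt IHu; rewrite -piD.
- by have := Pm _ _ IHt IHu; rewrite -piM.
Qed.

Lemma U_universal (A : algType K) (g : gen -> A) : U_relations g ->
  exists h : {lrmorphism U -> A}, (forall x, h (Ugen x) = g x) /\
    forall h' : {lrmorphism U -> A}, (forall x, h' (Ugen x) = g x) -> h' =1 h.
Proof.
move=> rg; exists (UevalM rg); split=> [x|h' hg]; first exact: (Ueval_gen rg).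
elim/U_ind => [x|c|x y IHx IHy|x y IHx IHy].
- by rewrite hg; symmetry; exact: (Ueval_gen rg).
- by rewrite !linearZ !rmorph1.
- by rewrite !rmorphD /= IHx IHy.
- by rewrite !rmorphM /= IHx IHy.
Qed.

End QuantumGroup.

Section GradedPieces.
Variables (K : fieldType) (A : algType K).

Inductive subalg_gen (S : set A) : set A :=
| Subalg_gen x : S x -> subalg_gen S x
| Subalg_one : subalg_gen S 1
| Subalg_lin c x y : subalg_gen S x -> subalg_gen S y -> subalg_gen S (c *: x + y)
| Subalg_mul x y : subalg_gen S x -> subalg_gen S y -> subalg_gen S (x * y).

(* The component of degree mu of the subalgebra generated by the g i, for the *)
(* grading in which g i has degree deg i.                                     *)
Inductive gr_comp (I : Type) (Q : zmodType) (g : I -> A) (deg : I -> Q) :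
    Q -> set A :=
| Gr_zero mu : gr_comp g deg mu 0
| Gr_one : gr_comp g deg 0 1
| Gr_gen i : gr_comp g deg (deg i) (g i)
| Gr_lin mu c x y : gr_comp g deg mu x -> gr_comp g deg mu y ->
    gr_comp g deg mu (c *: x + y)
| Gr_mul mu nu x y : gr_comp g deg mu x -> gr_comp g deg nu y ->
    gr_comp g deg (mu + nu) (x * y).

Definition is_basis (S : set A) (m : nat) (b : 'I_m -> A) : Prop :=
  (forall i, S (b i)) /\
  (forall x, S x -> exists! c : {ffun 'I_m -> K}, x = \sum_i c i *: b i).

Definition tpow (x xV : A) (k : int) : A :=
  match k with Posz m => x ^+ m | Negz m => xV ^+ m.+1 end.

End GradedPieces.

Section RMatrix.
Variables (K : fieldType) (r s : K) (n : nat).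
Local Notation U := (U r s n).
Local Notation e i := (Ugen r s (Ge i)).
Local Notation f i := (Ugen r s (Gf i)).
Local Notation w i := (Ugen r s (Gw i)).
Local Notation wV i := (Ugen r s (GwV i)).
Local Notation wp i := (Ugen r s (Gwp i)).
Local Notation wpV i := (Ugen r s (GwpV i)).

Definition Uge : set U :=
  subalg_gen [set x | exists i : 'I_n, [\/ x = e i, x = w i | x = wV i]].
Definition Ule : set U :=
  subalg_gen [set x | exists i : 'I_n, [\/ x = f i, x = wp i | x = wpV i]].

Definition Uplus (mu : rlat n) : set U :=
  gr_comp (fun i : 'I_n => e i) (fun i => alpha i) mu.
Definition Uminus (mu : rlat n) : set U :=
  gr_comp (fun i : 'I_n => f i) (fun i => - alpha i) mu.

(* omega_mu and omega'_mu for mu = root_comb k                                *)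
Definition omega (k : 'I_n -> int) : U := \prod_i tpow (w i) (wV i) (k i).
Definition omegap (k : 'I_n -> int) : U := \prod_i tpow (wp i) (wpV i) (k i).

Record is_coproduct (Delta : U -> tensor U U) : Prop := IsCoproduct {
  coproduct_linear : linear Delta;
  coproduct_mul : monoid_morphism Delta;
  coproduct_w : forall i, Delta (w i) = tens (w i) (w i);
  coproduct_wp : forall i, Delta (wp i) = tens (wp i) (wp i);
  coproduct_e : forall i, Delta (e i) = tens (e i) 1 + tens (w i) (e i);
  coproduct_f : forall i, Delta (f i) = tens 1 (f i) + tens (f i) (wp i)
}.

Definition in_pairs (S : set U) (ab : seq (U * U)) : Prop :=
  forall p, p \in ab -> S p.1 /\ S p.2.

(* Only the restriction of p to Ule * Uge is relevant. In [pairing_mull] and  *)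
(* [pairing_mulr], (y (x) y', Delta(x)) is computed from any expression of    *)
(* Delta(x) as a sum of tensors in Uge (x) Uge, and symmetrically.            *)
Record is_pairing (Delta : U -> tensor U U) (p : U -> U -> K) : Prop :=
  IsPairing {
  pairing_linl : forall c y y' x, Ule y -> Ule y' -> Uge x ->
    p (c *: y + y') x = c * p y x + p y' x;
  pairing_linr : forall c y x x', Ule y -> Uge x -> Uge x' ->
    p y (c *: x + x') = c * p y x + p y x';
  pairing_mull : forall y y' x ab, Ule y -> Ule y' -> Uge x -> in_pairs Uge ab ->
    Delta x = \sum_(q <- ab) tens q.1 q.2 ->
    p (y * y') x = \sum_(q <- ab) p y q.1 * p y' q.2;
  pairing_mulr : forall y x x' ab, Ule y -> Uge x -> Uge x' -> in_pairs Ule ab ->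
    Delta y = \sum_(q <- ab) tens q.1 q.2 ->
    p y (x * x') = \sum_(q <- ab) p q.1 x' * p q.2 x;
  pairing_fw : forall i j, p (f i) (w j) = 0;
  pairing_we : forall i j, p (wp i) (e j) = 0;
  pairing_fe : forall i j, p (f i) (e j) = (i == j)%:R / (ss s i - rr r i);
  pairing_ww : forall k l : 'I_n -> int,
    p (omegap k) (omega l) = chi r s (root_comb k) (root_comb l)
}.

Definition dual_bases (p : U -> U -> K) (mu : rlat n) (m : nat)
    (y x : 'I_m -> U) : Prop :=
  [/\ is_basis (Uminus (- mu)) y, is_basis (Uplus mu) x &
      forall i j, p (y i) (x j) = (i == j)%:R].

(* v_k is the (k-1)-st vector of the standard basis of 'cV[K]_N; k' is        *)
(* [rev_ord k]. Matrices act on column vectors from the left.                 *)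
Local Notation N := (2 * n).+1%N.
Definition E (i j : 'I_N) : 'M[K]_N := delta_mx i j.

(* eps_k, with eps_(n+1) = 0 and eps_(k') = - eps_k                           *)
Definition wt (k : 'I_N) : rlat n :=
  \row_j ((j == k :> nat)%:Z - (j == rev_ord k :> nat)%:Z).

Definition lo (i : 'I_n) : 'I_N := inord i.
Definition hi (i : 'I_n) : 'I_N := inord i.+1.

Definition has_weight (rho : U -> 'M[K]_N) (lambda : rlat n) (v : 'cV[K]_N) :=
  forall i, rho (w i) *m v = chi r s lambda (alpha i) *: v /\
            rho (wp i) *m v = (chi r s (alpha i) lambda)^-1 *: v.

Record is_vector_rep (rho : {lrmorphism U -> 'M[K]_N}) : Prop := IsVectorRep {
  vrep_weight : forall k, has_weight rho (wt k) (delta_mx k 0);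
  vrep_e : forall i, rho (e i) =
    E (lo i) (hi i) - E (rev_ord (hi i)) (rev_ord (lo i));
  vrep_f : forall i : 'I_n, (i.+1 < n)%N -> rho (f i) =
    E (hi i) (lo i) - (r * s) ^- 2 *: E (rev_ord (lo i)) (rev_ord (hi i));
  vrep_fn : forall i : 'I_n, i.+1 = n -> rho (f i) =
    (r^-1 + s^-1) *: (E (hi i) (lo i) - E (rev_ord (lo i)) (hi i))
}.

Definition actVV (Delta : U -> tensor U U) (rho : U -> 'M[K]_N) (u : U) :
    'M[K]_(N * N) :=
  tlift (fun a b => rho a *t rho b) (Delta u).

Definition tau : 'M[K]_(N * N) := \sum_i \sum_j E i j *t E j i.

(* f~ acts on the basis vector v_i (x) v_j, whose factors have weights        *)
(* wt i and wt j, by f(wt i, wt j).                                           *)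
Definition fwt (lambda mu : rlat n) : K := (chi r s mu lambda)^-1.
Definition ftilde : 'M[K]_(N * N) :=
  \sum_i \sum_j fwt (wt i) (wt j) *: (E i i *t E j j).

(* The sum over mu > 0 is the finitely supported sum of fsbigop: it is 0 when *)
(* infinitely many terms are nonzero.                                         *)
Definition Theta_mu (rho : U -> 'M[K]_N) (m : nat) (y x : 'I_m -> U) :
    'M[K]_(N * N) :=
  \sum_i rho (y i) *t rho (x i).
Definition Theta (rho : U -> 'M[K]_N) (m : rlat n -> nat)
    (y x : forall mu, 'I_(m mu) -> U) : 'M[K]_(N * N) :=
  1%:M + \sum_(mu \in [set mu | rlat_pos mu]) Theta_mu rho (@y mu) (@x mu).

Definition R_VV (rho : U -> 'M[K]_N) (m : rlat n -> nat)
    (y x : forall mu, 'I_(m mu) -> U) : 'M[K]_(N * N) :=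
  Theta rho y x *m ftilde *m tau.

(* For k : 'I_N, [idx k] is the index in 1, ..., 2n+1.                        *)
Definition idx (k : 'I_N) : int := k.+1%:Z.

Definition tt_ (k : 'I_N) : K :=
  if (k < n)%N then s ^ (2 * (idx k - n%:Z) - 1)
  else if k == n :> nat then s^-1
  else r ^ (2 * (n.+1%:Z - idx k) + 1).

Definition sigma (k : 'I_N) : int :=
  if (k < n)%N then - 1 else if k == n :> nat then 0 else 1.

(* For j != i, i', the second case is j < i < j' or j' < i < j.               *)
Definition acoef (i j : 'I_N) : K :=
  if (i < j)%N && (i < rev_ord j)%N || (j < i)%N && (rev_ord j < i)%N
  then (r * s) ^ (- (sigma i * sigma j))
  else (r * s) ^ (sigma i * sigma j).

Definition Rhat : 'M[K]_(N * N) :=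
  (r^-1 * s) *: (\sum_(i : 'I_N | i != n :> nat) E i i *t E i i)
  + \sum_(i : 'I_N | i == n :> nat) E i i *t E i i
  + (r * s^-1) *:
      (\sum_(i : 'I_N | i != n :> nat) E i (rev_ord i) *t E (rev_ord i) i)
  + \sum_(i : 'I_N) \sum_(j : 'I_N | (j != i) && (j != rev_ord i))
      acoef i j *: (E i j *t E j i)
  + ((r ^+ 2 - s ^+ 2) * (r * s)^-1) *:
      (\sum_(i : 'I_N | (i < n)%N)
         (r ^ (2 * (n%:Z - idx i) + 1) * s ^ (2 * (idx i - n%:Z) - 1) - 1)
         *: (E (rev_ord i) (rev_ord i) *t E i i))
  + ((s ^+ 2 - r ^+ 2) * (r * s)^-1) *:
      (\sum_(i : 'I_N) \sum_(j : 'I_N | (j < i)%N && (j != rev_ord i))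
         E i i *t E j j)
  + ((r ^+ 2 - s ^+ 2) * (r * s)^-1) *:
      (\sum_(i : 'I_N) \sum_(j : 'I_N | (i < j)%N && (j != rev_ord i))
         (tt_ i * (tt_ j)^-1) *: (E (rev_ord i) j *t E i (rev_ord j))).

End RMatrix.

(* C(r,s) is the fraction field of C[r][s], with C = R[i] for a model R of    *)
(* the real numbers.                                                          *)
Definition Crs (R : realType) := {fraction {poly {poly R[i]}}}.
Definition r_ind (R : realType) : Crs R := tofrac ('X : {poly R[i]})%:P.
Definition s_ind (R : realType) : Crs R := tofrac ('X : {poly {poly R[i]}}).

(* Main.v *)
Require Import Defs.
From mathcomp Require Import all_boot all_order all_algebra.
From mathcomp Require Import boolp classical_sets functions cardinality fsbigop.
From mathcomp Require Import reals complex mxtens.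
From mathcomp Require Import ring zify.

Set Implicit Arguments.
Unset Strict Implicit.
Unset Printing Implicit Defensive.

Import Order.TTheory GRing.Theory Num.Theory.
Local Open Scope ring_scope.

(* Both operators commute with the action of every e_j on V (x) V, and such an
   operator is determined by its rows of index (1, c), on which both are given by
   f alone.  For Rhat the commutation is a computation on basis vectors in which
   the sums telescope, since sum_i t_i v_i' (x) v_i is killed by e_j and f_j.  For
   Theta it follows from
     (e_j (x) 1 + w_j (x) e_j) Theta = Theta (e_j (x) 1 + w'_j (x) e_j),
   where [e_j, y] is expressed, for y in U^-, by two skew derivations which are
   the adjoints for the pairing of x |-> e_j x and x |-> x e_j; both facts are
   checked on monomials in the f_i.  The commutation of R with the whole of U is
   then that of Rhat, and R is invertible because Theta is unitriangular. *)

(** The obstacle is that [Theta] is known only through dual bases of [Uminus (- mu)] and [Uplus mu],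
    for which no explicit basis is at hand. Words in the generators span these spaces but are tied
    by the Serre relations, so a map defined on words need not descend to U^-. The skew derivations
    are therefore not treated as maps on U^-: for each homogeneous element some values are chosen,
    and only their pairings with U^+ are used, which determine coordinates in a dual basis. The rows
    of index (1, c) are within reach because v_1 has the highest weight: [Theta_mu] with mu > 0
    strictly lowers the first tensor factor, so these rows of Theta are rows of the identity. The
    term w'_j (x) e_j arises when the flipped coproduct of e_j is conjugated by f~. The numbers t_i
    are forced, up to a common factor, by the requirement that sum_i t_i v_i' (x) v_i be killed by
    the e_j; that the f_j kill it as well depends on the constants in f_j. *)

(** * The tensor basis of V (x) V and matrix units *)

Section TensorBasis.
Variables (K : fieldType) (n : nat).
Local Notation N := (2 * n).+1%N.

(* The basis vectors are indexed by all of nat: [bv k = 0] for [k > 2n]. *)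
Definition bv (k : nat) : 'cV[K]_N := \col_i (i == k :> nat)%:R.
Definition bvv (b d : nat) : 'M[K]_(N * N, 1 * 1) := bv b *t bv d.

Lemma bvE (k : 'I_N) : bv k = delta_mx k 0.
Proof. by apply/matrixP => i j; rewrite !mxE ord1 eqxx andbT. Qed.

Lemma bv_out k : (2 * n < k)%N -> bv k = 0.
Proof.
move=> lt_k; apply/colP => i; rewrite !mxE; case: eqP => // ik.
by have := ltn_ord i; rewrite ik ltnS leqNgt lt_k.
Qed.

Lemma bvvE b d (a c : 'I_N) i :
  bvv b d (mxtens_index (a, c)) i = (a == b :> nat)%:R * (c == d :> nat)%:R.
Proof. by case: (mxtens_indexP i) => i1 i2; rewrite tensmxE !mxE. Qed.

Lemma bvv_tens (A B : 'M[K]_N) b d :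
  (A *t B) *m bvv b d = (A *m bv b) *t (B *m bv d).
Proof. by rewrite -tensmx_mul. Qed.

Lemma tens_linear_l (m p m' p' : nat) (B : 'M[K]_(m', p')) c (A A' : 'M[K]_(m, p)) :
  (c *: A + A') *t B = c *: (A *t B) + A' *t B.
Proof. by apply/matrixP => i j; rewrite !mxE mulrDl mulrA. Qed.

Lemma tens_linear_r (m p m' p' : nat) (A : 'M[K]_(m, p)) c (B B' : 'M[K]_(m', p')) :
  A *t (c *: B + B') = c *: (A *t B) + A *t B'.
Proof. by apply/matrixP => i j; rewrite !mxE mulrDr mulrCA. Qed.

Lemma tens_scale_l (m p m' p' : nat) c (A : 'M[K]_(m, p)) (B : 'M[K]_(m', p')) :
  (c *: A) *t B = c *: (A *t B).
Proof. by apply/matrixP => i j; rewrite !mxE mulrA. Qed.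

Lemma tens_scale_r (m p m' p' : nat) c (A : 'M[K]_(m, p)) (B : 'M[K]_(m', p')) :
  A *t (c *: B) = c *: (A *t B).
Proof. by apply/matrixP => i j; rewrite !mxE mulrCA. Qed.

Lemma mulmx_bvv (q : nat) (A : 'M[K]_(q, N * N)) (b d : 'I_N) i j :
  (A *m bvv b d) i j = A i (mxtens_index (b, d)).
Proof.
rewrite mxE (bigD1 (mxtens_index (b, d))) //= big1 ?addr0 => [|k].
  by rewrite mxE mxtens_indexK !mxE !eqxx !mulr1.
case: (mxtens_indexP k) => b' d' ne; rewrite mxE mxtens_indexK !mxE.
case: eqP => [/val_inj eb|]; last by rewrite mul0r mulr0.
case: eqP => [/val_inj ed|]; last by rewrite mulr0 mulr0.
by move: ne; rewrite /= in eb ed *; rewrite eb ed eqxx.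
Qed.

Lemma eq_mx_bvv (q : nat) (A B : 'M[K]_(q, N * N)) :
  (forall b d : 'I_N, A *m bvv b d = B *m bvv b d) -> A = B.
Proof.
move=> H; apply/matrixP => i k; case: (mxtens_indexP k) => b d.
by rewrite -!(mulmx_bvv _ _ _ _ ord0) H.
Qed.

Lemma tens11 : (1%:M : 'M[K]_N) *t (1%:M : 'M[K]_N) = 1%:M.
Proof. by apply: eq_mx_bvv => b d; rewrite bvv_tens !mul1mx. Qed.

Lemma E_bv (i j : 'I_N) (k : nat) : E K i j *m bv k = (j == k :> nat)%:R *: bv i.
Proof.
rewrite bvE /E; apply/matrixP => a c; rewrite !mxE (bigD1 j) //= big1 => [|l ne].
  by rewrite !mxE eqxx andbT !ord1 /= eqxx andbT addr0 mulrC.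
by rewrite !mxE (negPf ne) andbF mul0r.
Qed.

Lemma EE_bvv (i j k l : 'I_N) (b d : nat) : (E K i j *t E K k l) *m bvv b d =
  ((j == b :> nat)%:R * (l == d :> nat)%:R) *: bvv i k.
Proof. by rewrite bvv_tens !E_bv tens_scale_l tens_scale_r scalerA. Qed.

End TensorBasis.

(** * Operators of the shape of Rhat against raising and lowering operators *)

Section Braid.
Variables (K : fieldType) (n : nat) (A : nat -> nat -> K) (t : nat -> K) (q : K).
Local Notation N := (2 * n).+1%N.
Local Notation bvv := (bvv K n).
Hypothesis t_neq0 : forall i, t i != 0.

(* The action of Rhat on the basis. With indices starting at 0, primed indices
   are k' = 2n - k. The fifth sum of Rhat splits into the terms i = j' left out
   of the last two sums, so that these become sums over all i > j and i < j. *)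
Definition braid_sum (b : nat) : 'M[K]_(N * N, 1 * 1) :=
  \sum_(i < b) t i *: bvv (2 * n - i) i.

Definition braid_vec (b d : nat) : 'M[K]_(N * N, 1 * 1) :=
  A d b *: bvv d b - (q * (d < b)%:R) *: bvv b d
  + (q * (d == 2 * n - b)%N%:R / t b) *: braid_sum b.

Definition is_braid (R : 'M[K]_(N * N)) : Prop :=
  forall b d, (b <= 2 * n)%N -> (d <= 2 * n)%N -> R *m bvv b d = braid_vec b d.

Lemma braid_sumS b : braid_sum b.+1 = braid_sum b + t b *: bvv (2 * n - b) b.
Proof. by rewrite /braid_sum big_ord_recr. Qed.

Variable R : 'M[K]_(N * N).
Hypothesis R_braid : is_braid R.

(* [D] has the shape of Delta(e_j): e_j lowers the index of a basis vector, and
   [k] lists the eigenvalues of omega_j. *)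
Section Raise.
Variables (k eps : nat -> K) (D : 'M[K]_(N * N)).
Hypothesis D_bvv : forall b d, (b <= 2 * n)%N -> (d <= 2 * n)%N ->
  D *m bvv b d = eps b *: bvv b.-1 d + (k b * eps d) *: bvv b d.-1.
Hypothesis eps0 : eps 0 = 0.
Hypothesis k_neq0 : forall b, k b != 0.
Hypothesis k_rev : forall b, (b <= 2 * n)%N -> k (2 * n - b) = (k b)^-1.
(** [alphaH] and [betaH] compare the coefficients of v_(d-1) (x) v_b and of v_d (x) v_(b-1) in D R
    and R D applied to v_b (x) v_d. The right side of [betaH] collects boundary terms: the first two
    come from the jumps of the indicator [d < b], the last two from the ends of the truncated sums.
    [tH] is the vanishing of the component along v_(i+1)' (x) v_i when D is applied to the full sum
    of the t_i v_i' (x) v_i. *)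
Hypothesis alphaH : forall b d, (b <= 2 * n)%N -> (d <= 2 * n)%N ->
  eps d != 0 -> A d b = k b * A d.-1 b.
Hypothesis betaH : forall b d, (b <= 2 * n)%N -> (d <= 2 * n)%N -> eps b != 0 ->
  k d * A d b - A d b.-1 = q * ((d == b.-1)%:R - k b * (d == b)%:R
     + (k b)^-1 * (d == 2 * n - b)%N%:R - (d == 2 * n - b.-1)%N%:R).
Hypothesis tH : forall i, (i < 2 * n)%N ->
  t i * eps (2 * n - i) + t i.+1 * k (2 * n - i.+1) * eps i.+1 = 0.

(** By [tH], the action of D on the first factor of term i cancels its action on the second factor
    of term i + 1. Only the first-factor image of the last term survives; the second-factor image of
    term 0 is zero by [eps0]. *)
Lemma raise_braid_sum b : (b < 2 * n)%N ->
  D *m braid_sum b.+1 = (t b * eps (2 * n - b)) *: bvv (2 * n - b.+1) b.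
Proof.
elim: b => [|b IH] lt_b; rewrite braid_sumS mulmxDr -scalemxAr D_bvv; try lia.
  rewrite /braid_sum big_ord0 mulmx0 add0r eps0 mulr0 scale0r addr0 scalerA.
  by rewrite subn0 subn1.
rewrite IH; last lia.
have e1 : (2 * n - b.+1).-1 = (2 * n - b.+2)%N by lia.
rewrite e1 /=; have := tH (ltnW lt_b).
move: (bvv (2 * n - b.+2) b.+1) (bvv (2 * n - b.+1) b) => x y H.
apply/matrixP => i j; rewrite !mxE; apply/eqP; rewrite -subr_eq0; apply/eqP.
by rewrite -[RHS](mulr0 (y i j)) -H; ring.
Qed.

Lemma braid_raise b d : (b <= 2 * n)%N -> (d <= 2 * n)%N ->
  D *m (R *m bvv b d) = R *m (D *m bvv b d).
Proof.
move=> le_b le_d.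
have DE : D *m (q * (d == 2 * n - b)%N%:R / t b *: braid_sum b) =
    - (q * (d == 2 * n - b)%N%:R * eps b / k b) *: bvv d b.-1.
  case: b le_b => [|b] le_b.
    rewrite /braid_sum big_ord0 scaler0 mulmx0 eps0 mulr0 mul0r.
    by rewrite oppr0 scale0r.
  rewrite -scalemxAr raise_braid_sum // scalerA /=.
  case: (eqVneq d (2 * n - b.+1)%N) => [->|_]; last by rewrite !mulr0 !mul0r oppr0 !scale0r.
  have /eqP := tH le_b; rewrite addr_eq0 => /eqP ->; rewrite k_rev //.
  by congr (_ *: _); field; rewrite t_neq0 k_neq0.
(* The conditions d = (b-1)' and d - 1 = b' coincide, so truncated sums of lengths b - 1 and b occur
   together; by [tH] they cancel except for the extra term of the longer one. *)
have RE : eps b *: (R *m bvv b.-1 d) + (k b * eps d) *: (R *m bvv b d.-1) =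
    eps b *: (A d b.-1 *: bvv d b.-1 - (q * (d < b.-1)%:R) *: bvv b.-1 d)
    + (k b * eps d) *: (A d.-1 b *: bvv d.-1 b - (q * (d.-1 < b)%:R) *: bvv b d.-1)
    - (q * (d == 2 * n - b.-1)%N%:R * eps b) *: bvv d b.-1.
  rewrite !R_braid ?(leq_trans (leq_pred _)) // /braid_vec !scalerDr -!addrA.
  congr (_ + _); congr (_ + _); rewrite addrCA; congr (_ + _).
  rewrite addrCA; congr (_ + _).
  case: b le_b {DE} => [|b] le_b.
    rewrite eps0 !scale0r add0r /braid_sum big_ord0 !scaler0 mulr0 scale0r.
    by rewrite oppr0.
  rewrite /= braid_sumS; case: (eqVneq d (2 * n - b)%N) => [->|ne].
    have -> : ((2 * n - b).-1 == 2 * n - b.+1)%N by apply/eqP; lia.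
    have /eqP := tH le_b; rewrite addr_eq0 => /eqP H.
    have /(congr1 (fun z => z / t b)) := H; rewrite mulrAC mulfV ?t_neq0 // mul1r => ->.
    rewrite k_rev //.
    move: (braid_sum b) (bvv (2 * n - b) b) => x y.
    apply/matrixP => i j; rewrite !mxE; field.
    by rewrite !t_neq0 k_neq0.
  have [d0|d0] := eqVneq d 0%N.
    by rewrite !d0 eps0 !mulr0 !mul0r !scale0r scaler0 addr0 oppr0.
  have -> : (d.-1 == 2 * n - b.+1)%N = false by apply/eqP => h; case/eqP: ne; lia.
  by rewrite !(mulr0, mul0r, scale0r, scaler0) addr0 oppr0.
rewrite [RHS](_ : _ = eps b *: (R *m bvv b.-1 d) + (k b * eps d) *: (R *m bvv b d.-1));
  last by rewrite D_bvv // mulmxDr -!scalemxAr.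
rewrite RE R_braid // /braid_vec !mulmxDr DE mulmxN -!scalemxAr !D_bvv //.
(* At d = b - 1 the vectors v_(b-1) (x) v_d and v_d (x) v_(b-1) coincide, so the jump of [d < b] can
   be charged to the latter; [L2] does the same at d = b. *)
have L1 : (eps b * (d < b)%:R) *: bvv b.-1 d =
    (eps b * (d < b.-1)%:R) *: bvv b.-1 d + (eps b * (d == b.-1)%:R) *: bvv d b.-1.
  case: b {le_b DE RE} => [|b]; first by rewrite eps0 !mul0r !scale0r addr0.
  rewrite /= ltnS leq_eqVlt; case: eqVneq => [->|_] /=.
    by rewrite ltnn mulr0 scale0r add0r.
  by rewrite mulr0 scale0r addr0.
have L2 : (k b * eps d * (d < b)%:R) *: bvv b d.-1 =
    (k b * eps d * (d.-1 < b)%:R) *: bvv b d.-1 - (k b * eps b * (d == b)%:R) *: bvv d b.-1.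
  have [->|d0] := eqVneq d 0%N.
    case: b {le_b DE RE L1} => [|b]; rewrite eps0 !(mulr0, mul0r, scale0r) ?sub0r ?oppr0 //.
  case: d d0 {le_d DE RE L1} => // d _; rewrite /= [in RHS]leq_eqVlt.
  case: eqVneq => [<-|_] /=; last by rewrite mulr0 scale0r subr0.
  by rewrite ltnn !mulr1 mulr0 scale0r subrr.
have [a1 a2] : eps d * (A d b - k b * A d.-1 b) = 0 /\
   eps b * (k d * A d b - A d b.-1) = eps b * (q * ((d == b.-1)%:R - k b * (d == b)%:R
     + (k b)^-1 * (d == 2 * n - b)%N%:R - (d == 2 * n - b.-1)%N%:R)).
  split; first by have [->|e] := eqVneq (eps d) 0; rewrite ?mul0r // -alphaH // subrr mulr0.
  by have [->|e] := eqVneq (eps b) 0; rewrite ?mul0r // betaH.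
move: L1 L2 {DE RE}; move: (bvv b.-1 d) (bvv b d.-1) (bvv d b.-1) (bvv d.-1 b) => x y z w.
move=> /matrixP L1 /matrixP L2; apply/matrixP => i j.
move: (L1 i j) (L2 i j); rewrite !mxE.
move: (x i j) (y i j) (z i j) (w i j) => {L1 L2} {}x {}y {}z {}w L1 L2.
apply/eqP; rewrite -subr_eq0; apply/eqP.
transitivity (w * (eps d * (A d b - k b * A d.-1 b))
  + z * (eps b * (k d * A d b - A d b.-1)
     - eps b * (q * ((d == b.-1)%:R - k b * (d == b)%:R
     + (k b)^-1 * (d == 2 * n - b)%N%:R - (d == 2 * n - b.-1)%N%:R)))
  - q * (eps b * (d < b)%:R * x - (eps b * (d < b.-1)%:R * x + eps b * (d == b.-1)%:R * z))
  - q * (k b * eps d * (d < b)%:R * y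
     - (k b * eps d * (d.-1 < b)%:R * y - k b * eps b * (d == b)%:R * z))).
  by field.
by rewrite a1 a2 L1 L2; ring.
Qed.

End Raise.
(* [D] has the shape of Delta(f_j), and [k] lists the eigenvalues of omega'_j. *)
Section Lower.
Variables (k phi : nat -> K) (D : 'M[K]_(N * N)).
Hypothesis D_bvv : forall b d, (b <= 2 * n)%N -> (d <= 2 * n)%N ->
  D *m bvv b d = phi d *: bvv b d.+1 + (k d * phi b) *: bvv b.+1 d.
Hypothesis phi_max : phi (2 * n) = 0.
Hypothesis k_neq0 : forall b, k b != 0.
Hypothesis k_rev : forall b, (b <= 2 * n)%N -> k (2 * n - b) = (k b)^-1.
Hypothesis alphaH : forall b d, (b <= 2 * n)%N -> (d <= 2 * n)%N ->
  phi b != 0 -> A d b = k d * A d b.+1.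
Hypothesis betaH : forall b d, (b <= 2 * n)%N -> (d <= 2 * n)%N -> phi d != 0 ->
  k b * A d b - A d.+1 b = q * ((b == d.+1)%:R - k b * (b == d)%:R
     + k b * (d == 2 * n - b)%N%:R - (d.+1 == 2 * n - b)%N%:R).
Hypothesis tH : forall i, (i < 2 * n)%N ->
  t i * phi i + t i.+1 * k i.+1 * phi (2 * n - i.+1) = 0.

(** The factors exchange roles: the action on the second factor of term i cancels that on the first
    factor of term i + 1. The first factor of term 0 is the last basis vector, which D kills. *)
Lemma lower_braid_sum b : (b <= 2 * n)%N ->
  D *m braid_sum b.+1 = (t b * phi b) *: bvv (2 * n - b) b.+1.
Proof.
elim: b => [|b IH] lt_b; rewrite braid_sumS mulmxDr -scalemxAr D_bvv; try lia.
  rewrite /braid_sum big_ord0 mulmx0 add0r subn0 phi_max mulr0 scale0r addr0.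
  by rewrite scalerA.
rewrite IH; last lia.
have -> : (2 * n - b.+1).+1 = (2 * n - b)%N by lia.
have := tH lt_b.
move: (bvv (2 * n - b.+1) b.+2) (bvv (2 * n - b) b.+1) => x y H.
apply/matrixP => i j; rewrite !mxE; apply/eqP; rewrite -subr_eq0; apply/eqP.
by rewrite -[RHS](mulr0 (y i j)) -H; ring.
Qed.

Lemma braid_lower b d : (b <= 2 * n)%N -> (d <= 2 * n)%N ->
  D *m (R *m bvv b d) = R *m (D *m bvv b d).
Proof.
move=> le_b le_d.
have DE : D *m (q * (d == 2 * n - b)%N%:R / t b *: braid_sum b) =
    - (q * (d == 2 * n - b)%N%:R * phi d * k b) *: bvv d.+1 b.
  case: b le_b => [|b] le_b.
    rewrite /braid_sum big_ord0 scaler0 mulmx0 subn0.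
    case: eqVneq => [->|_]; last by rewrite mulr0 !mul0r oppr0 scale0r.
    by rewrite phi_max mulr0 mul0r oppr0 scale0r.
  rewrite -scalemxAr lower_braid_sum ?(ltnW le_b) // scalerA.
  case: (eqVneq d (2 * n - b.+1)%N) => [->|_]; last first.
    by rewrite !mulr0 !mul0r oppr0 !scale0r.
  have -> : (2 * n - b.+1).+1 = (2 * n - b)%N by lia.
  have /eqP := tH le_b; rewrite addr_eq0 => /eqP ->.
  by congr (_ *: _); field; rewrite t_neq0.
have RE : phi d *: (R *m bvv b d.+1) + (k d * phi b) *: (R *m bvv b.+1 d) =
    phi d *: (A d.+1 b *: bvv d.+1 b - (q * (d.+1 < b)%:R) *: bvv b d.+1)
    + (k d * phi b) *: (A d b.+1 *: bvv d b.+1 - (q * (d < b.+1)%:R) *: bvv b.+1 d)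
    - (q * (d.+1 == 2 * n - b)%N%:R * phi d) *: bvv d.+1 b.
  (* [R_braid] covers indices up to 2n only, so the cases in which b + 1 or d + 1 leaves this range
     are treated apart; there [phi] vanishes. *)
  have [dm|dm] := eqVneq d (2 * n)%N.
    have [bm|bm] := eqVneq b (2 * n)%N.
      rewrite dm bm phi_max !(mulr0, mul0r, scale0r) addr0 add0r.
      by rewrite oppr0.
    have p0 : phi d = 0 by rewrite dm.
    rewrite p0 !scale0r add0r R_braid; [|lia..]; rewrite /braid_vec.
    have -> : (d == 2 * n - b.+1)%N = false by apply/eqP; lia.
    by rewrite !(mulr0, mul0r, scale0r) add0r subr0 addr0.
  have [bm|bm] := eqVneq b (2 * n)%N.
    have p0 : phi b = 0 by rewrite bm.
    rewrite p0 mulr0 !scale0r !addr0 R_braid; [|lia..]; rewrite /braid_vec.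
    have -> : (d.+1 == 2 * n - b)%N = false by apply/eqP; lia.
    by rewrite !(mulr0, mul0r, scale0r) subr0 addr0.
  rewrite !R_braid; try lia; rewrite /braid_vec !scalerDr -!addrA.
  congr (_ + _); congr (_ + _); rewrite addrCA; congr (_ + _).
  rewrite addrCA; congr (_ + _).
  rewrite braid_sumS; case: (eqVneq d.+1 (2 * n - b)%N) => [e|ne].
    have e' : (d = 2 * n - b.+1)%N by lia.
    rewrite e' eqxx.
    have e1 : (2 * n - b.+1).+1 = (2 * n - b)%N by lia.
    have lt_b : (b < 2 * n)%N by lia.
    have /eqP := tH lt_b; rewrite addr_eq0 => /eqP H.
    have /(congr1 (fun z => z / t b)) := H; rewrite mulrAC mulfV ?t_neq0 // mul1r => ->.
    rewrite k_rev // e1.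
    move: (braid_sum b) (bvv (2 * n - b) b) => x y.
    apply/matrixP => i j; rewrite !mxE; field.
    by rewrite !t_neq0 k_neq0.
  have -> : (d == 2 * n - b.+1)%N = false by apply/eqP => h; case/eqP: ne; lia.
  by rewrite !(mulr0, mul0r, scale0r, scaler0) addr0 oppr0.
rewrite [RHS](_ : _ = phi d *: (R *m bvv b d.+1) + (k d * phi b) *: (R *m bvv b.+1 d));
  last by rewrite D_bvv // mulmxDr -!scalemxAr.
rewrite RE R_braid // /braid_vec !mulmxDr DE mulmxN -!scalemxAr !D_bvv //.
have L1 : (phi d * (d < b)%:R) *: bvv b d.+1 =
    (phi d * (d.+1 < b)%:R) *: bvv b d.+1 + (phi d * (b == d.+1)%:R) *: bvv d.+1 b.
  rewrite [in LHS]leq_eqVlt eq_sym; case: eqVneq => [->|_] /=.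
    by rewrite ltnn mulr0 scale0r add0r.
  by rewrite mulr0 scale0r addr0.
have L2 : (k d * phi b * (d < b)%:R) *: bvv b.+1 d =
    (k d * phi b * (d < b.+1)%:R) *: bvv b.+1 d - (k b * phi d * (b == d)%:R) *: bvv d.+1 b.
  rewrite [in RHS]ltnS [in RHS]leq_eqVlt eq_sym.
  case: eqVneq => [<-|_] /=; last by rewrite mulr0 scale0r subr0.
  by rewrite ltnn !mulr1 mulr0 scale0r subrr.
have [a1 a2] : phi b * (A d b - k d * A d b.+1) = 0 /\
   phi d * (k b * A d b - A d.+1 b) = phi d * (q * ((b == d.+1)%:R - k b * (b == d)%:R
     + k b * (d == 2 * n - b)%N%:R - (d.+1 == 2 * n - b)%N%:R)).
  split; first by have [->|e] := eqVneq (phi b) 0; rewrite ?mul0r // -alphaH // subrr mulr0.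
  by have [->|e] := eqVneq (phi d) 0; rewrite ?mul0r // betaH.
move: L1 L2 {DE RE}; move: (bvv b.+1 d) (bvv b d.+1) (bvv d b.+1) (bvv d.+1 b) => x y z w.
move=> /matrixP L1 /matrixP L2; apply/matrixP => i j.
move: (L1 i j) (L2 i j); rewrite !mxE.
move: (x i j) (y i j) (z i j) (w i j) => {L1 L2} {}x {}y {}z {}w L1 L2.
apply/eqP; rewrite -subr_eq0; apply/eqP.
transitivity (z * (phi b * (A d b - k d * A d b.+1))
  + w * (phi d * (k b * A d b - A d.+1 b)
     - phi d * (q * ((b == d.+1)%:R - k b * (b == d)%:R
     + k b * (d == 2 * n - b)%N%:R - (d.+1 == 2 * n - b)%N%:R)))
  - q * (phi d * (d < b)%:R * y - (phi d * (d.+1 < b)%:R * y + phi d * (b == d.+1)%:R * w))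
  - q * (k d * phi b * (d < b)%:R * x
     - (k d * phi b * (d < b.+1)%:R * x - k b * phi d * (b == d)%:R * w))).
  by field.
by rewrite a1 a2 L1 L2; ring.
Qed.

End Lower.
End Braid.

(** The reflection k -> k' = 2n - k negates weights and fixes the middle index n, so identities in
    the weights are checked on the first half, in the middle, and on the reflected half, where
    characters are inverted. *)
Lemma fold_index (n : nat) (P : nat -> Prop) :
  (forall d, (d < n)%N -> P d) -> P n -> (forall d, (d < n)%N -> P (2 * n - d)%N) ->
  forall d, (d <= 2 * n)%N -> P d.
Proof.
move=> P1 P2 P3 d le_d; case: (ltngtP d n) => [|lt_d|->] //; first exact: P1.
by rewrite -(subKn le_d); apply: P3; lia.
Qed.

(** * Weights in the basis eps *)

Section WeightLattice.
Variable n : nat.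
Local Notation N := (2 * n).+1%N.

Lemma rsformDl (x y z : rlat n) : rsform (x + y) z = rsform x z + rsform y z.
Proof.
rewrite /rsform -big_split; apply: eq_bigr => i _ /=; rewrite -big_split.
by apply: eq_bigr => j _ /=; rewrite mxE !mulrDl.
Qed.

Lemma rsformDr (x y z : rlat n) : rsform x (y + z) = rsform x y + rsform x z.
Proof.
rewrite /rsform -big_split; apply: eq_bigr => i _ /=; rewrite -big_split.
by apply: eq_bigr => j _ /=; rewrite mxE !(mulrDl, mulrDr).
Qed.

Lemma rsform_delta (i j : 'I_n) :
  rsform (delta_mx 0 i) (delta_mx 0 j) = if (i < j)%N then - 1 else 1.
Proof.
rewrite /rsform (bigD1 i) //= [X in _ + X]big1 ?addr0 => [|k ne].
  rewrite (bigD1 j) //= big1 => [|k ne]; first by rewrite !mxE !eqxx !mul1r addr0.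
  by rewrite !mxE (negPf ne) !(mulr0, mul0r).
by apply: big1 => l _; rewrite !mxE (negPf ne) !mul0r.
Qed.

(** [wt] on natural numbers, so that neighbours k + 1 and reflections 2n - k need no ordinals.
    Values beyond 2n carry no meaning. *)
Definition wtn (k : nat) : rlat n := \row_j ((j == k :> nat)%:Z - (j == 2 * n - k :> nat)%N%:Z).

Lemma rev_ordN (k : 'I_N) : rev_ord k = (2 * n - k)%N :> nat.
Proof. by rewrite /= subSS. Qed.

Lemma wt_wtn (k : 'I_N) : wt k = wtn k.
Proof. by apply/rowP => j; rewrite !mxE rev_ordN. Qed.

Lemma wtn_delta (i : 'I_n) : wtn i = delta_mx 0 i.
Proof.
apply/rowP => j; rewrite !mxE eqxx /=.
have -> : (j == 2 * n - i :> nat)%N = false by apply/eqP; have := ltn_ord j; have := ltn_ord i; lia.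
by rewrite subr0 val_eqE; case: (j == i).
Qed.

Lemma wtn_rev k : (k <= 2 * n)%N -> wtn (2 * n - k) = - wtn k.
Proof. by move=> le_k; apply/rowP => j; rewrite !mxE subKn // opprB. Qed.

Lemma wtn_mid : wtn n = 0.
Proof.
apply/rowP => j; rewrite !mxE; have -> : (2 * n - n = n)%N by lia.
by rewrite subrr.
Qed.

(** Uniform in j: for the short root eps_n the subtracted weight is that of the middle vector, which
    is 0. *)
Lemma alpha_wtn (j : 'I_n) : alpha j = wtn j - wtn j.+1.
Proof.
apply/rowP => i; rewrite !mxE -val_eqE /=; have := ltn_ord i; have := ltn_ord j.
move=> lt_j lt_i.
have -> : (i == 2 * n - j :> nat)%N = false by apply/eqP; lia.
have -> : (i == 2 * n - j.+1 :> nat)%N = false by apply/eqP; lia.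
by rewrite !subr0.
Qed.

Lemma loE (j : 'I_n) : lo j = j :> nat.
Proof. by rewrite /lo inordK //; have := ltn_ord j; lia. Qed.

Lemma hiE (j : 'I_n) : hi j = j.+1 :> nat.
Proof. by rewrite /hi inordK //; have := ltn_ord j; lia. Qed.

Lemma ord_le (b : 'I_N) : (b <= 2 * n)%N.
Proof. by rewrite -ltnS. Qed.

End WeightLattice.

(** * Identities in r and s behind the commutation relations *)

Section RootPowers.
Variables (K : fieldType) (r s : K) (n : nat).
Hypotheses (r_neq0 : r != 0) (s_neq0 : s != 0).
Local Notation N := (2 * n).+1%N.
Local Notation chi := (@chi K r s n).
Local Notation wtn := (wtn n).

Lemma chiDl x y z : chi (x + y) z = chi x z * chi y z.
Proof. by rewrite /chi rsformDl rsformDr opprD !expfzDr // mulrACA. Qed.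

Lemma chiDr x y z : chi x (y + z) = chi x y * chi x z.
Proof. by rewrite /chi rsformDl rsformDr opprD !expfzDr // mulrACA. Qed.

Lemma chi_neq0 x y : chi x y != 0.
Proof. by rewrite mulf_neq0 // expfz_neq0. Qed.

Lemma chi0l x : chi 0 x = 1.
Proof. by apply: (mulfI (chi_neq0 0 x)); rewrite -chiDl add0r mulr1. Qed.

Lemma chi0r x : chi x 0 = 1.
Proof. by apply: (mulfI (chi_neq0 x 0)); rewrite -chiDr add0r mulr1. Qed.

Lemma chiNl x y : chi (- x) y = (chi x y)^-1.
Proof. by apply: (mulfI (chi_neq0 x y)); rewrite -chiDl subrr chi0l mulfV ?chi_neq0. Qed.

Lemma chiNr x y : chi x (- y) = (chi x y)^-1.
Proof. by apply: (mulfI (chi_neq0 x y)); rewrite -chiDr subrr chi0r mulfV ?chi_neq0. Qed.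

Definition chiw (a b : nat) : K := chi (wtn a) (wtn b).

Lemma chiw_neq0 a b : chiw a b != 0. Proof. exact: chi_neq0. Qed.

Lemma chiw_revl a b : (a <= 2 * n)%N -> chiw (2 * n - a) b = (chiw a b)^-1.
Proof. by move=> le_a; rewrite /chiw wtn_rev // chiNl. Qed.

Lemma chiw_revr a b : (b <= 2 * n)%N -> chiw a (2 * n - b) = (chiw a b)^-1.
Proof. by move=> le_b; rewrite /chiw wtn_rev // chiNr. Qed.

Lemma chiw_midl b : chiw n b = 1. Proof. by rewrite /chiw wtn_mid chi0l. Qed.
Lemma chiw_midr b : chiw b n = 1. Proof. by rewrite /chiw wtn_mid chi0r. Qed.

Lemma chiwE a b : (a < n)%N -> (b < n)%N ->
  chiw a b = if (a < b)%N then (r * s)^-1 else if a == b then r / s else r * s.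
Proof.
move=> lt_a lt_b; rewrite /chiw (wtn_delta (Ordinal lt_a)) (wtn_delta (Ordinal lt_b)).
rewrite /chi !rsform_delta /=.
by case: ltngtP => _; rewrite ?opprK ?expr1z ?exprN1 ?invfM.
Qed.

Lemma chiw_cases a b : (a < n)%N -> (b < n)%N ->
  [\/ [/\ (a < b)%N, chiw a b = (r * s)^-1 & chiw b a = r * s],
      [/\ a = b, chiw a b = r / s & chiw b a = r / s] |
      [/\ (b < a)%N, chiw a b = r * s & chiw b a = (r * s)^-1]].
Proof.
move=> lt_a lt_b; case: (ltngtP a b) => [ab|ab|->].
- by constructor 1; rewrite !chiwE // ab ltnNge ltnW // gtn_eqF.
- by constructor 3; rewrite !chiwE // ab ltnNge ltnW // gtn_eqF.
by constructor 2; rewrite !chiwE // ltnn eqxx.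
Qed.

(* The eigenvalues of omega_(j+1) and omega'_(j+1) on v_(b+1). *)
Definition wE (j b : nat) : K := chiw b j / chiw b j.+1.
Definition wF (j b : nat) : K := chiw j.+1 b / chiw j b.

Lemma chi_wE (j : 'I_n) b : chi (wtn b) (alpha j) = wE j b.
Proof. by rewrite alpha_wtn chiDr chiNr. Qed.

Lemma chi_wF (j : 'I_n) b : (chi (alpha j) (wtn b))^-1 = wF j b.
Proof. by rewrite alpha_wtn chiDl chiNl invfM invrK mulrC. Qed.

Lemma wE_neq0 j b : wE j b != 0.
Proof. by rewrite mulf_neq0 ?invr_eq0 ?chiw_neq0. Qed.

Lemma wF_neq0 j b : wF j b != 0.
Proof. by rewrite mulf_neq0 ?invr_eq0 ?chiw_neq0. Qed.

Lemma wE_rev j b : (b <= 2 * n)%N -> wE j (2 * n - b) = (wE j b)^-1.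
Proof. by move=> le_b; rewrite /wE !chiw_revl // -invfM. Qed.

Lemma wF_rev j b : (b <= 2 * n)%N -> wF j (2 * n - b) = (wF j b)^-1.
Proof. by move=> le_b; rewrite /wF !chiw_revr // -invfM. Qed.

(* e_(j+1) and f_(j+1) move v_(b+1) to [eps j b] v_b and [phi _ _ j b] v_(b+2). *)
Definition eps (j b : nat) : K := (b == j.+1)%:R - (b == 2 * n - j)%N%:R.
Definition phi (c c' : K) (j b : nat) : K := c * (b == j)%:R - c' * (b == 2 * n - j.+1)%N%:R.

(* f(eps_d, eps_b); this is also the coefficient of E_db (x) E_bd in Rhat. *)
Definition fcoef (d b : nat) : K := (chiw b d)^-1.
Definition qdiff : K := (r ^+ 2 - s ^+ 2) * (r * s)^-1.

Definition tcoef (k : nat) : K :=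
  if (k < n)%N then s ^ (2 * (k.+1%:Z - n%:Z) - 1)
  else if k == n then s^-1
  else r ^ (2 * (n.+1%:Z - k.+1%:Z) + 1).

Lemma tcoef_neq0 k : tcoef k != 0.
Proof. by rewrite /tcoef; case: ifP => _; [|case: ifP => _]; rewrite ?invr_eq0 ?expfz_neq0. Qed.

Lemma eps_neq0 j b : eps j b != 0 -> b = j.+1 \/ b = (2 * n - j)%N.
Proof.
rewrite /eps; have [->|_] := eqVneq b j.+1; first by left.
have [->|_] := eqVneq b (2 * n - j)%N; first by right.
by rewrite subrr eqxx.
Qed.

Lemma phi_neq0 c c' j b : phi c c' j b != 0 -> b = j \/ b = (2 * n - j.+1)%N.
Proof.
rewrite /phi; have [->|_] := eqVneq b j; first by left.
have [->|_] := eqVneq b (2 * n - j.+1)%N; first by right.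
by rewrite !mulr0 subrr eqxx.
Qed.

Variable j : nat.
Hypothesis lt_j : (j < n)%N.

(** Passing from v_d to v_(d-1) by e_j adds alpha_j to the weight, on the first half and on the
    reflected half alike; since [chi] is multiplicative in each argument, this costs the factor
    [wE j b]. *)
Lemma alpha_raise b d : (b <= 2 * n)%N -> (d <= 2 * n)%N ->
  eps j d != 0 -> fcoef d b = wE j b * fcoef d.-1 b.
Proof.
move=> le_b le_d /eps_neq0[->|->]; rewrite /fcoef /wE /=.
  by field; rewrite !chiw_neq0 ?oner_neq0.
have -> : (2 * n - j).-1 = (2 * n - j.+1)%N by lia.
rewrite !chiw_revr; try lia.
by field; rewrite !chiw_neq0 oner_neq0.
Qed.

Lemma alpha_lower c c' b d : (b <= 2 * n)%N -> (d <= 2 * n)%N ->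
  phi c c' j b != 0 -> fcoef d b = wF j d * fcoef d b.+1.
Proof.
move=> le_b le_d /phi_neq0[->|->]; rewrite /fcoef /wF /=.
  by field; rewrite !chiw_neq0 ?oner_neq0.
have -> : (2 * n - j.+1).+1 = (2 * n - j)%N by lia.
rewrite !chiw_revl; try lia.
by field; rewrite !chiw_neq0 ?oner_neq0.
Qed.

Lemma succ_cases : j.+1 = n \/ (j.+1 < n)%N.
Proof. by move: lt_j; rewrite leq_eqVlt => /orP[/eqP|]; [left | right]. Qed.

Ltac decide_eqs := repeat (case: eqP => ?; [try (exfalso; lia) | try (exfalso; lia)]).

(** For i equal to j or j + 1, [chiw d i] and [chiw i d] are inverse to each other unless d is i or
    i'. Hence both sides vanish unless d is one of j, j + 1 and their reflections; what remains
    rests on [qdiff] being r/s - s/r. *)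
Lemma beta_raise b d : (b <= 2 * n)%N -> (d <= 2 * n)%N -> eps j b != 0 ->
  wE j d * fcoef d b - fcoef d b.-1 = qdiff * ((d == b.-1)%:R - wE j b * (d == b)%:R
     + (wE j b)^-1 * (d == 2 * n - b)%N%:R - (d == 2 * n - b.-1)%N%:R).
Proof.
move=> le_b le_d.
have jj : chiw j j = r / s by rewrite chiwE // ltnn eqxx.
have pm : (2 * n - j).-1 = (2 * n - j.+1)%N by lia.
have pj : (2 * n - (2 * n - j) = j)%N by lia.
have pj1 : (2 * n - (2 * n - j.+1) = j.+1)%N by lia.
move=> /eps_neq0[->|->]; rewrite ?pm /= ?pj ?pj1; rewrite /fcoef ?(wE_rev j) /wE; try lia.
all: rewrite ?chiw_revl; try lia.
all: move: d le_d; apply: fold_index => [d lt_d||d lt_d]; rewrite ?chiw_revl ?chiw_revr; try lia.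
all: rewrite ?chiw_midr ?chiw_midl.
all: case: succ_cases => [e|lt_j1]; rewrite ?e ?chiw_midr ?chiw_midl.
all: try (have j1j1 : chiw j.+1 j.+1 = r / s by rewrite chiwE // ltnn eqxx).
all: try have jj1 : chiw j j.+1 = (r * s)^-1 by rewrite chiwE // ltnSn.
all: try have j1j : chiw j.+1 j = (r * s) by rewrite chiwE // ltnNge leqnSn /= gtn_eqF.
all: try case: (chiw_cases lt_d lt_j) => [][h1 H1 H1'].
all: try case: (chiw_cases lt_d lt_j1) => [][h2 H2 H2'].
all: try (exfalso; lia).
all: rewrite ?H1 ?H1' ?H2 ?H2' ?jj ?jj1 ?j1j ?j1j1 /qdiff.
all: decide_eqs.
all: rewrite /= ?(mulr1n, mulr0n); field.
all: by rewrite ?r_neq0 ?s_neq0 ?oner_neq0 ?invr_eq0 ?mulf_neq0.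
Qed.
Lemma beta_lower c c' b d : (b <= 2 * n)%N -> (d <= 2 * n)%N -> phi c c' j d != 0 ->
  wF j b * fcoef d b - fcoef d.+1 b = qdiff * ((b == d.+1)%:R - wF j b * (b == d)%:R
     + wF j b * (d == 2 * n - b)%N%:R - (d.+1 == 2 * n - b)%N%:R).
Proof.
move=> le_b le_d.
have jj : chiw j j = r / s by rewrite chiwE // ltnn eqxx.
have pm : (2 * n - j.+1).+1 = (2 * n - j)%N by lia.
move=> /phi_neq0[->|->]; rewrite ?pm /= /fcoef /wF.
all: rewrite ?chiw_revr; try lia.
all: move: b le_b; apply: fold_index => [b lt_b||b lt_b]; rewrite ?chiw_revl ?chiw_revr; try lia.
all: rewrite ?chiw_midr ?chiw_midl.
all: case: succ_cases => [e|lt_j1]; rewrite ?e ?chiw_midr ?chiw_midl.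
all: try (have j1j1 : chiw j.+1 j.+1 = r / s by rewrite chiwE // ltnn eqxx).
all: try case: (chiw_cases lt_b lt_j) => [][h1 H1 H1'].
all: try case: (chiw_cases lt_b lt_j1) => [][h2 H2 H2'].
all: try (exfalso; lia).
all: rewrite ?H1 ?H1' ?H2 ?H2' ?jj ?j1j1 /qdiff.
all: decide_eqs.
all: rewrite /= ?(mulr1n, mulr0n); field.
all: by rewrite ?r_neq0 ?s_neq0 ?oner_neq0 ?invr_eq0 ?mulf_neq0.
Qed.

(** The ratio is s^2 for a long root and 1 for the short one; on the reflected half it is r^2,
    respectively r/s. These are the ratios needed for e_j to kill sum_i t_i v_i' (x) v_i, and they
    dictate the exponents of [tcoef]. *)
Lemma tcoef_succ_lo : tcoef j.+1 = wE j j.+1 * tcoef j.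
Proof.
rewrite /wE; case: succ_cases => [e|lt_j1].
  by rewrite e !chiw_midl invr1 mulr1 mul1r /tcoef ltnn eqxx lt_j e mulrC subrr.
rewrite !chiwE // ltnn eqxx ltnNge leqnSn /= gtn_eqF // /tcoef lt_j lt_j1.
have -> : 2 * (j.+2%:Z - n%:Z) - 1 = 2 + (2 * (j.+1%:Z - n%:Z) - 1) by lia.
rewrite expfzDr //; move: (s ^ (2 * (j.+1%:Z - n%:Z) - 1)) => z.
by rewrite -exprnP; field; rewrite r_neq0 s_neq0.
Qed.

Lemma tcoef_succ_hi : tcoef (2 * n - j.+1) = wE j j * tcoef (2 * n - j).
Proof.
have g j' : (j' < n)%N -> tcoef (2 * n - j') = r ^ (2 * (j'%:Z - n%:Z) + 1).
  move=> lt_j'; rewrite /tcoef ltnNge (_ : n <= 2 * n - j')%N /=; last lia.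
  rewrite gtn_eqF; last lia.
  by congr (_ ^ _); lia.
rewrite /wE; case: succ_cases => [e|lt_j1].
  rewrite e chiw_midr chiwE // ltnn eqxx (g j) // invr1 mulr1 /tcoef.
  have -> : (2 * n - n = n)%N by lia.
  rewrite ltnn eqxx; have -> : 2 * (j%:Z - n%:Z) + 1 = - 1 by lia.
  by rewrite exprN1; field; rewrite r_neq0 s_neq0.
rewrite !chiwE // ltnn eqxx ltnSn !g //.
have -> : 2 * (j.+1%:Z - n%:Z) + 1 = 2 + (2 * (j%:Z - n%:Z) + 1) by lia.
rewrite expfzDr //; move: (r ^ (2 * (j%:Z - n%:Z) + 1)) => z.
by rewrite -exprnP; field; rewrite r_neq0 s_neq0 oner_neq0.
Qed.

(** Only i = j and i = (j+1)' give nonzero terms; there the two signs in e_j make the ratios of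
    successive t_i cancel the two contributions. *)
Lemma tcoef_raise i : (i < 2 * n)%N ->
  tcoef i * eps j (2 * n - i) + tcoef i.+1 * wE j (2 * n - i.+1) * eps j i.+1 = 0.
Proof.
move=> lt_i; have [->|ne1] := eqVneq i j.
  rewrite wE_rev ?tcoef_succ_lo; last lia.
  rewrite /eps eqxx eqxx; have -> : (2 * n - j == j.+1)%N = false by apply/eqP; lia.
  have -> : (j.+1 == 2 * n - j)%N = false by apply/eqP; lia.
  by field; rewrite wE_neq0.
have [->|ne2] := eqVneq i (2 * n - j.+1)%N.
  have -> : (2 * n - j.+1).+1 = (2 * n - j)%N by lia.
  have -> : (2 * n - (2 * n - j.+1) = j.+1)%N by lia.
  have -> : (2 * n - (2 * n - j) = j)%N by lia.
  rewrite tcoef_succ_hi /eps !eqxx.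
  have -> : (2 * n - j == j.+1)%N = false by apply/eqP; lia.
  have -> : (j.+1 == 2 * n - j)%N = false by apply/eqP; lia.
  by ring.
rewrite /eps; have -> : (i.+1 == j.+1) = false by exact/negbTE.
have -> : (i.+1 == 2 * n - j)%N = false by apply/eqP => h; case/eqP: ne2; lia.
have -> : (2 * n - i == 2 * n - j)%N = false by apply/eqP => h; case/eqP: ne1; lia.
have -> : (2 * n - i == j.+1)%N = false by apply/eqP => h; case/eqP: ne2; lia.
by rewrite subrr !mulr0 addr0.
Qed.

(** The hypothesis ties together the two entries of f_j. It holds for 1 and (rs)^(-2) at a long root
    and for equal entries at the short root, so the constants in f_j are those for which the vector
    killed by the e_j is also killed by the f_j. *)
Lemma tcoef_lower c c' i : c' * wF j j.+1 = c / wE j j.+1 -> (i < 2 * n)%N ->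
  tcoef i * phi c c' j i + tcoef i.+1 * wF j i.+1 * phi c c' j (2 * n - i.+1) = 0.
Proof.
move=> cc lt_i; have [->|ne1] := eqVneq i j.
  rewrite tcoef_succ_lo /phi !eqxx; have -> : (2 * n - j.+1 == j)%N = false by apply/eqP; lia.
  have -> : (j == 2 * n - j.+1)%N = false by apply/eqP; lia.
  transitivity (tcoef j * (c - wE j j.+1 * (c' * wF j j.+1))).
    by rewrite /= ?(mulr1n, mulr0n); ring.
  by rewrite cc [wE _ _ * _]mulrC divfK ?wE_neq0 // subrr mulr0.
have [->|ne2] := eqVneq i (2 * n - j.+1)%N.
  have -> : (2 * n - j.+1).+1 = (2 * n - j)%N by lia.
  have -> : (2 * n - (2 * n - j) = j)%N by lia.
  (* Both products are (rs)^2 for a long root and 1 for the short one. *)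
  have ww : wF j j * wE j j = wF j j.+1 * wE j j.+1.
    rewrite /wF /wE; case: succ_cases => [e|lt_j1].
      by rewrite e !(chiw_midl, chiw_midr); field; rewrite ?(chiw_neq0, r_neq0, s_neq0, oner_neq0).
    rewrite !chiwE // !(ltnn, eqxx, ltnSn) ltnNge leqnSn /= gtn_eqF //.
    by field; rewrite ?(chiw_neq0, r_neq0, s_neq0, oner_neq0).
  rewrite tcoef_succ_hi wF_rev; last lia.
  rewrite /phi !eqxx.
  have -> : (2 * n - j.+1 == j)%N = false by apply/eqP; lia.
  have -> : (j == 2 * n - j.+1)%N = false by apply/eqP; lia.
  transitivity (tcoef (2 * n - j) / wF j j * (c - c' * (wF j j * wE j j))).
    by rewrite /= ?(mulr1n, mulr0n); field; rewrite ?(wF_neq0, oner_neq0).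
  by rewrite ww mulrA cc mulfVK ?wE_neq0 // subrr mulr0.
rewrite /phi; have -> : (i == j) = false by exact/negbTE.
have -> : (i == 2 * n - j.+1)%N = false by exact/negbTE.
have -> : (2 * n - i.+1 == 2 * n - j.+1)%N = false by apply/eqP => h; case/eqP: ne1; lia.
have -> : (2 * n - i.+1 == j)%N = false by apply/eqP => h; case/eqP: ne2; lia.
by rewrite !mulr0 subrr !mulr0 addr0.
Qed.

End RootPowers.

(** * The action of Rhat on the tensor basis *)

Section RhatBraid.
Variables (K : fieldType) (r s : K) (n : nat).
Hypotheses (r_neq0 : r != 0) (s_neq0 : s != 0).
Local Notation N := (2 * n).+1%N.
Local Notation bvv := (bvv K n).

Lemma sum_delta (V : lmodType K) (I : finType) (P : pred I) (b : I) (F : I -> V) :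
  \sum_(i | P i) (i == b)%:R *: F i = if P b then F b else 0.
Proof.
case: ifP => Pb; last by apply: big1 => i Pi; case: eqP Pi => [->|]; rewrite ?Pb ?scale0r.
by rewrite (bigD1 b) //= eqxx scale1r big1 ?addr0 // => i /andP[_ /negPf->]; rewrite scale0r.
Qed.

Lemma sum_delta2 (V : lmodType K) (I J : finType) (P : I -> pred J) (b : I) (d : J)
    (F : I -> J -> V) :
  \sum_i \sum_(j | P i j) ((i == b)%:R * (j == d)%:R) *: F i j = if P b d then F b d else 0.
Proof.
rewrite -(sum_delta (P b) d (F b)) -[RHS](sum_delta xpredT b
  (fun i => \sum_(j | P i j) (j == d)%:R *: F i j)) /=.
by apply: eq_bigr => i _; rewrite scaler_sumr; apply: eq_bigr => j _; rewrite scalerA.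
Qed.

Definition sgn (k : nat) : int :=
  if (k < n)%N then - 1 else if k == n :> nat then 0 else 1.

Lemma sgn_lo k : (k < n)%N -> sgn k = - 1. Proof. by rewrite /sgn => ->. Qed.
Lemma sgn_mid : sgn n = 0. Proof. by rewrite /sgn ltnn eqxx. Qed.
Lemma sgn_hi k : (k < n)%N -> sgn (2 * n - k) = 1.
Proof.
move=> lt_k; rewrite /sgn; have -> : (2 * n - k < n)%N = false by lia.
by have -> : (2 * n - k == n)%N = false by lia.
Qed.

(** Replacing b by b' or d by d' leaves the condition unchanged and inverts both sides, and a middle
    index makes both sides 1. For b and d in the first half the condition just says d < b. *)
Lemma fcoef_sgn (b d : nat) : (b <= 2 * n)%N -> (d <= 2 * n)%N ->
    (b != d)%N -> (b != 2 * n - d)%N ->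
  fcoef r s n d b =
  if (d < b)%N && (d < 2 * n - b)%N || (b < d)%N && (2 * n - b < d)%N
  then (r * s) ^ (- (sgn d * sgn b)) else (r * s) ^ (sgn d * sgn b).
Proof.
rewrite /fcoef; move: b; apply: fold_index => [b lt_b||b lt_b].
all: move: d; apply: fold_index => [d lt_d||d lt_d].
all: rewrite ?(chiw_revl r_neq0 s_neq0) ?(chiw_revr r_neq0 s_neq0); [|lia..].
all: rewrite ?(chiw_midl _ r_neq0 s_neq0) ?(chiw_midr _ r_neq0 s_neq0).
all: rewrite ?sgn_mid ?sgn_hi ?sgn_lo // ?mulr0 ?mul0r ?oppr0 ?expr0z ?if_same ?invr1 //.
all: case: (chiw_cases r s lt_b lt_d) => [][h H _] e1 e2; rewrite H.
all: try (exfalso; clear -e1 e2 h lt_b lt_d; lia).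
all: match goal with |- context [if ?c then _ else _] =>
  first [have -> : c = true by clear -h e1 e2 lt_b lt_d; lia |
         have -> : c = false by clear -h e1 e2 lt_b lt_d; lia] end.
all: rewrite ?mulrN1 ?mulN1r ?mul1r ?opprK ?exprN1 ?expr1z ?invrK //.
Qed.

Lemma fcoef_acoef (b d : 'I_N) : b != d -> b != rev_ord d -> fcoef r s n d b = acoef r s d b.
Proof.
rewrite -!val_eqE /= subSS /acoef !rev_ordN; apply: fcoef_sgn; rewrite -ltnS; exact: ltn_ord.
Qed.

Lemma fcoef_diag b : (b <= 2 * n)%N -> b != n -> fcoef r s n b b = r^-1 * s.
Proof.
rewrite /fcoef; move: b; apply: fold_index => [b lt_b _||b lt_b _]; last 2 first.
- by rewrite eqxx.
- rewrite chiw_revl ?chiw_revr //; [|lia..].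
  by rewrite invrK chiwE // ltnn eqxx invfM invrK.
by rewrite chiwE // ltnn eqxx invfM invrK.
Qed.

Lemma fcoef_rev b : (b <= 2 * n)%N -> b != n -> fcoef r s n (2 * n - b) b = r * s^-1.
Proof.
move=> le_b ne_b; have := fcoef_diag le_b ne_b; rewrite /fcoef chiw_revr // => ->.
by rewrite invfM invrK.
Qed.

Lemma fcoef_mid : fcoef r s n n n = 1.
Proof. by rewrite /fcoef chiw_midl // invr1. Qed.

Lemma Rhat_braid : is_braid (fcoef r s n) (tcoef r s n) (qdiff r s) (Rhat r s n).
Proof.
move=> b d le_b le_d; have lt_b : (b < N)%N by []; have lt_d : (d < N)%N by [].
rewrite -[b]/(val (Ordinal lt_b)) -[d]/(val (Ordinal lt_d)).
move: (Ordinal lt_b) (Ordinal lt_d) => {le_b le_d lt_b lt_d} {}b {}d /=.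
have rev_eq (i j : 'I_N) : (rev_ord i == j) = (i == rev_ord j).
  by rewrite -(inj_eq rev_ord_inj) rev_ordK.
have EEo (i j k l : 'I_N) : (E K i j *t E K k l) *m bvv b d =
    ((j == b)%:R * (l == d)%:R) *: bvv i k by rewrite EE_bvv !val_eqE.
rewrite /Rhat !mulmxDl -!scalemxAl !mulmx_suml.
rewrite (eq_bigr (fun i => (i == b)%:R *: ((b == d)%:R *: bvv d b))); last first.
  move=> i _; rewrite EEo -scalerA; case: (eqVneq i b) => [->|_]; last by rewrite !scale0r.
  by case: eqVneq => [->|_]; rewrite ?scale0r.
rewrite sum_delta.
rewrite (eq_bigr (fun i => (i == b)%:R *: ((b == d)%:R *: bvv d b))); last first.
  move=> i _; rewrite EEo -scalerA; case: (eqVneq i b) => [->|_]; last by rewrite !scale0r.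
  by case: eqVneq => [->|_]; rewrite ?scale0r.
rewrite sum_delta.
rewrite (eq_bigr (fun i => (i == d)%:R *: ((d == rev_ord b)%:R *: bvv d b))); last first.
  move=> i _; rewrite EEo mulrC -scalerA rev_eq.
  case: (eqVneq i d) => [->|_]; last by rewrite !scale0r.
  by case: eqVneq => [->|_]; rewrite ?rev_ordK ?scale0r.
rewrite sum_delta.
rewrite (eq_bigr (fun i => \sum_(j | (j != i) && (j != rev_ord i))
    ((i == d)%:R * (j == b)%:R) *: (acoef r s i j *: bvv i j))); last first.
  move=> i _; rewrite mulmx_suml; apply: eq_bigr => j _.
  by rewrite -scalemxAl EEo !scalerA mulrC [_ * (i == d)%:R]mulrC.
rewrite sum_delta2.
pose c (i : 'I_N) := r ^ (2 * (n%:Z - idx i) + 1) * s ^ (2 * (idx i - n%:Z) - 1) - 1.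
rewrite (eq_bigr (fun i : 'I_N => (i == d)%:R *: ((d == rev_ord b)%:R *: (c d *: bvv b d))));
  last first.
  move=> i _; rewrite -/(c i) -scalemxAl EEo rev_eq !scalerA.
  case: (eqVneq i d) => [->|_]; last by rewrite !(mulr0, mul0r) !scale0r.
  by case: eqVneq => [->|_]; rewrite ?rev_ordK ?(mulr1, mul1r, mulr0, mul0r, scale0r).
rewrite sum_delta.
rewrite (eq_bigr (fun i : 'I_N => \sum_(j : 'I_N | (j < i)%N && (j != rev_ord i))
    ((i == b)%:R * (j == d)%:R) *: bvv i j)); last first.
  by move=> i _; rewrite mulmx_suml; apply: eq_bigr => j _; rewrite EEo.
rewrite sum_delta2.
rewrite (eq_bigr (fun i : 'I_N => if (i < b)%N && (b != rev_ord i) then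
    ((d == rev_ord b)%:R * (tcoef r s n i / tcoef r s n b)) *: bvv (2 * n - i) i else 0)); last first.
  move=> i _; rewrite mulmx_suml.
  rewrite (eq_bigr (fun j : 'I_N => (j == b)%:R *:
    (((d == rev_ord b)%:R * (tcoef r s n i / tcoef r s n b))
       *: bvv (2 * n - i) i))); first by rewrite sum_delta.
  move=> j _; rewrite -scalemxAl EEo rev_ordN !scalerA -/(tcoef r s n i).
  case: (eqVneq j b) => [->|_]; last by rewrite !(mulr0, mul0r).
  by rewrite eq_sym mulrC !mul1r mulrC.
rewrite -big_mkcond /=.
rewrite -/(qdiff r s).
have -> : (s ^+ 2 - r ^+ 2) / (r * s) = - qdiff r s by rewrite /qdiff; ring.
have le_b : (b <= 2 * n)%N by rewrite -ltnS.
have le_d : (d <= 2 * n)%N by rewrite -ltnS.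
have revE (i j : 'I_N) : (i == rev_ord j) = (i == 2 * n - j :> nat)%N.
  by rewrite -(rev_ordN j) val_eqE.
(* On v_d (x) v_b the first four sums together contribute f(eps_d, eps_b): in their order they treat
   b = d off the middle, b = d in the middle, b = d', and all other pairs. *)
have -> : (r^-1 * s) *: (if b != n :> nat then (b == d)%:R *: bvv d b else 0) +
  (if b == n :> nat then (b == d)%:R *: bvv d b else 0) +
  (r / s) *: (if d != n :> nat then (d == rev_ord b)%:R *: bvv d b else 0) +
  (if (b != d) && (b != rev_ord d) then acoef r s d b *: bvv d b else 0) =
  fcoef r s n d b *: bvv d b.
  case: (eqVneq b d) => [<-|ne1] /=.
    rewrite addr0 !scale1r revE; case: (eqVneq (b : nat) n) => [e|ne] /=.
      by rewrite e fcoef_mid !scaler0 add0r addr0 scale1r.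
    have -> : (b == 2 * n - b :> nat)%N = false by apply/eqP => h; case/eqP: ne; lia.
    by rewrite scale0r scaler0 !addr0 fcoef_diag.
  rewrite !scale0r !if_same scaler0 !add0r.
  case: (eqVneq b (rev_ord d)) => [e|ne2] /=.
    rewrite e rev_ordK eqxx scale1r addr0; case: (eqVneq (d : nat) n) => [e'|ne] /=.
      by case/eqP: ne1; apply/eqP; rewrite e eq_sym revE e'; apply/eqP; lia.
    congr (_ *: _); rewrite subSS -(fcoef_rev (b := 2 * n - d)) ?leq_subr ?subKn //.
    by apply/eqP => h; case/eqP: ne; lia.
  have -> : (d == rev_ord b) = false by rewrite -rev_eq eq_sym; apply/negbTE.
  by rewrite scale0r if_same scaler0 add0r fcoef_acoef.
rewrite /braid_vec -!addrA; congr (_ + _); rewrite -revE.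
case: (eqVneq d (rev_ord b)) => [e|ne] /=; last first.
  rewrite scale0r if_same scaler0 add0r andbT big1 => [|i _]; last by rewrite mul0r scale0r.
  rewrite scaler0 addr0 mulr0 mul0r scale0r addr0.
  by case: ifP; rewrite ?mulr1 ?scaleNr ?mulr0 ?scaler0 ?scale0r ?oppr0.
rewrite andbF scaler0 add0r scale1r mulr1.
(* [braid_sum] also contains the term i = b' = d, which the last sum of Rhat excludes; it is present
   only if d < b. *)
have -> : \sum_(i < N | (i < b)%N && (b != rev_ord i))
     (1 * (tcoef r s n i / tcoef r s n b)) *: bvv (2 * n - i) i =
   (tcoef r s n b)^-1 *: braid_sum n (tcoef r s n) b -
   (if (d < b)%N then (tcoef r s n d / tcoef r s n b) *: bvv b d else 0).
  have le_bN : (b <= N)%N by apply: leq_trans le_b _.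
  rewrite /braid_sum (big_ord_widen N (fun i => tcoef r s n i *: bvv (2 * n - i) i)) // scaler_sumr.
  case: ifP => lt_db; last first.
    rewrite subr0; apply: eq_big => [i|i _]; last by rewrite mul1r scalerA mulrC.
    case: eqP => [h|]; last by rewrite andbT.
    rewrite andbF; apply/esym/negbTE; rewrite -leqNgt leqNgt.
    by apply/negP; move: lt_db; rewrite e h rev_ordK => ->.
  rewrite [in RHS](bigD1 d) //= e rev_ordN subKn // scalerA [_^-1 * _]mulrC addrC addrK.
  apply: eq_big => [i|i _]; last by rewrite mul1r scalerA mulrC.
  by congr (_ && _); rewrite eq_sym rev_eq.
rewrite scalerBr scalerA addrCA [RHS]addrC; congr (_ + _).
have -> : (d < b)%N = (d < n)%N by rewrite e rev_ordN; apply/idP/idP; lia.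
case: ifP => lt_d; last by rewrite !scaler0 oppr0 mulr0 scale0r oppr0 addr0.
(* The coefficient in the fifth sum is t_d / t_d' - 1: the quotient supplies the missing term of the
   last sum, and -1 that of the sixth. *)
rewrite mulr1 /c; have -> : r ^ (2 * (n%:Z - idx d) + 1) * s ^ (2 * (idx d - n%:Z) - 1) =
    tcoef r s n d / tcoef r s n b.
  rewrite /tcoef lt_d (_ : b < n = false)%N; last by move: lt_d; rewrite e rev_ordN; lia.
  rewrite (_ : b == n :> nat = false)%N; last by move: lt_d; rewrite e rev_ordN; lia.
  rewrite mulrC invr_expz; congr (_ * _ ^ _).
  by rewrite /idx; move: lt_d; rewrite e rev_ordN; lia.
by rewrite !scalerA mulrBr mulr1 scalerBl addrAC subrr add0r.
Qed.

End RhatBraid.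

(** * The action of U on V (x) V and its commutation with Rhat *)

Section VectorRep.
Variables (K : fieldType) (r s : K) (n : nat).
Hypotheses (r_neq0 : r != 0) (s_neq0 : s != 0).
Local Notation N := (2 * n).+1%N.
Local Notation bv := (bv K n).
Local Notation bvv := (bvv K n).
Local Notation U := (U r s n).
Local Notation e i := (Ugen r s (Ge i)).
Local Notation f i := (Ugen r s (Gf i)).
Local Notation w i := (Ugen r s (Gw i)).
Local Notation wp i := (Ugen r s (Gwp i)).
Variable rho : {lrmorphism U -> 'M[K]_N}.
Hypothesis rho_vec : is_vector_rep rho.

Lemma rho_e (j : 'I_n) b : rho (e j) *m bv b = eps K n j b *: bv b.-1.
Proof.
rewrite vrep_e // mulmxBl !E_bv !rev_ordN loE hiE /eps scalerBl; congr (_ - _).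
  by rewrite eq_sym; case: eqP => [->|_]; rewrite ?scale0r.
rewrite eq_sym; case: eqP => [->|_]; rewrite ?scale0r //.
by congr (_ *: bv _); lia.
Qed.

Definition lowc (j : nat) : K := if (j.+1 < n)%N then 1 else r^-1 + s^-1.
Definition lowc' (j : nat) : K := if (j.+1 < n)%N then (r * s) ^- 2 else r^-1 + s^-1.

Lemma rho_f (j : 'I_n) b :
  rho (f j) *m bv b = phi n (lowc j) (lowc' j) j b *: bv b.+1.
Proof.
have lt_j := ltn_ord j; rewrite /phi /lowc /lowc'.
have cases : (E K (hi j) (lo j) *m bv b = (b == j)%:R *: bv b.+1) *
   (E K (rev_ord (lo j)) (rev_ord (hi j)) *m bv b = (b == 2 * n - j.+1)%N%:R *: bv b.+1).
  rewrite !E_bv !rev_ordN loE hiE; split; rewrite eq_sym.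
    by case: eqP => [->|_]; rewrite ?scale0r.
  case: eqP => [->|_]; rewrite ?scale0r //.
  by congr (_ *: bv _); lia.
case: ltnP => lt_j1.
  rewrite vrep_f // mulmxBl -scalemxAl !cases mul1r scalerBl.
  by rewrite scalerA.
have e1 : j.+1 = n by lia.
rewrite vrep_fn //; have -> : E K (rev_ord (lo j)) (hi j) = E K (rev_ord (lo j)) (rev_ord (hi j)).
  by congr (E K _ _); apply/val_inj; rewrite /= subSS hiE e1 mul2n -addnn addnK.
by rewrite -scalemxAl mulmxBl !cases -scalerBl scalerA mulrBr.
Qed.

Lemma rho_w (j : 'I_n) b : rho (w j) *m bv b = wE r s n j b *: bv b.
Proof.
case: (ltnP b N) => [lt_b|le_b]; last first.
  by rewrite bv_out // mulmx0 scaler0.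
have := (vrep_weight rho_vec (Ordinal lt_b) j).1.
by rewrite -bvE /= wt_wtn chi_wE.
Qed.

Lemma rho_wp (j : 'I_n) b : rho (wp j) *m bv b = wF r s n j b *: bv b.
Proof.
case: (ltnP b N) => [lt_b|le_b]; last first.
  by rewrite bv_out // mulmx0 scaler0.
have := (vrep_weight rho_vec (Ordinal lt_b) j).2.
by rewrite -bvE /= wt_wtn chi_wF.
Qed.

Lemma lowc_eq (j : nat) : (j < n)%N ->
  lowc' j * wF r s n j j.+1 = lowc j / wE r s n j j.+1.
Proof.
move=> lt_j; rewrite /lowc /lowc' /wE /wF; case: ltnP => lt_j1.
  rewrite !chiwE // !(ltnn, eqxx, ltnSn) ltnNge leqnSn /= gtn_eqF //.
  by field; rewrite r_neq0 s_neq0 oner_neq0.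
have -> : j.+1 = n by lia.
by rewrite !chiw_midl // !chiw_midr // !(mulr1, invr1).
Qed.

Variable Delta : U -> tensor U U.
Hypothesis Delta_cop : is_coproduct Delta.
Local Notation act := (actVV Delta rho).

Lemma rho_bilinear :
  bilinear_for *:%R *:%R (fun a b : U => rho a *t rho b).
Proof.
by split=> [b|a] c x y; rewrite /= linearP /= ?tens_linear_l ?tens_linear_r.
Qed.

Lemma Delta_add x y : Delta (x + y) = Delta x + Delta y.
Proof. by rewrite -[x]scale1r (coproduct_linear Delta_cop) !scale1r. Qed.

Lemma act_add x y : act (x + y) = act x + act y.
Proof. by rewrite /actVV Delta_add (tlift_add rho_bilinear). Qed.

Lemma act_1 : act 1 = 1%:M.
Proof.
rewrite /actVV (coproduct_mul Delta_cop).1 (tlift_tens rho_bilinear) !rmorph1.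
exact: tens11.
Qed.

Lemma act_scale c x : act (c *: x) = c *: act x.
Proof.
have D0 : Delta 0 = 0.
  by apply: (addrI (Delta 0)); rewrite -Delta_add !addr0.
have -> : act (c *: x) = tlift (fun a b => rho a *t rho b) (c *: Delta x).
  by rewrite /actVV -[c *: x]addr0 (coproduct_linear Delta_cop) D0 !addr0.
exact: (tlift_scale rho_bilinear).
Qed.

Lemma act_mul x y : act (x * y) = act x *m act y.
Proof.
rewrite /actVV (coproduct_mul Delta_cop).2 (tlift_mul rho_bilinear).
rewrite {1}/tlift {1}/tsum [X in _ = X *m _]/tlift /tsum mulmx_suml.
apply: eq_bigr => q _; rewrite /tlift /tsum mulmx_sumr; apply: eq_bigr => t _.
by rewrite !rmorphM -tensmx_mul.
Qed.

Lemma act_e j : act (e j) = rho (e j) *t 1%:M + rho (w j) *t rho (e j).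
Proof.
rewrite /actVV (coproduct_e Delta_cop) (tlift_add rho_bilinear).
by rewrite !(tlift_tens rho_bilinear) rmorph1.
Qed.

Lemma act_f j : act (f j) = 1%:M *t rho (f j) + rho (f j) *t rho (wp j).
Proof.
rewrite /actVV (coproduct_f Delta_cop) (tlift_add rho_bilinear).
by rewrite !(tlift_tens rho_bilinear) rmorph1.
Qed.

Lemma act_w j : act (w j) = rho (w j) *t rho (w j).
Proof. by rewrite /actVV (coproduct_w Delta_cop) (tlift_tens rho_bilinear). Qed.

Lemma act_wp j : act (wp j) = rho (wp j) *t rho (wp j).
Proof. by rewrite /actVV (coproduct_wp Delta_cop) (tlift_tens rho_bilinear). Qed.

Lemma act_e_bvv (j : 'I_n) b d : act (e j) *m bvv b d =
  eps K n j b *: bvv b.-1 d + (wE r s n j b * eps K n j d) *: bvv b d.-1.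
Proof.
rewrite act_e mulmxDl !bvv_tens !rho_e rho_w mul1mx.
by rewrite !tens_scale_l tens_scale_r scalerA.
Qed.

Lemma act_f_bvv (j : 'I_n) b d : act (f j) *m bvv b d =
  phi n (lowc j) (lowc' j) j d *: bvv b d.+1
  + (wF r s n j d * phi n (lowc j) (lowc' j) j b) *: bvv b.+1 d.
Proof.
rewrite act_f mulmxDl !bvv_tens !rho_f rho_wp mul1mx.
by rewrite !tens_scale_l !tens_scale_r scalerA [wF _ _ _ _ _ * _]mulrC.
Qed.

Lemma act_w_bvv (j : 'I_n) b d : act (w j) *m bvv b d =
  (wE r s n j b * wE r s n j d) *: bvv b d.
Proof.
by rewrite act_w bvv_tens !rho_w tens_scale_l tens_scale_r scalerA.
Qed.

Lemma act_wp_bvv (j : 'I_n) b d : act (wp j) *m bvv b d =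
  (wF r s n j b * wF r s n j d) *: bvv b d.
Proof.
by rewrite act_wp bvv_tens !rho_wp tens_scale_l tens_scale_r scalerA.
Qed.

Lemma eps_0 j : (j < n)%N -> eps K n j 0 = 0.
Proof.
move=> lt_j; rewrite /eps (_ : 0 == 2 * n - j = false)%N ?subrr //.
by apply/eqP; lia.
Qed.

Lemma phi_max c c' j : (j < n)%N -> phi n c c' j (2 * n) = 0 :> K.
Proof.
move=> lt_j; rewrite /phi (_ : 2 * n == j = false)%N; last by apply/eqP; lia.
by rewrite (_ : 2 * n == 2 * n - j.+1 = false)%N ?mulr0 ?subrr //; apply/eqP; lia.
Qed.

Local Notation Rh := (Rhat r s n).
Let Rh_braid := Rhat_braid r_neq0 s_neq0 (n := n).

Lemma Rhat_e j : Rh *m act (e j) = act (e j) *m Rh.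
Proof.
apply: eq_mx_bvv => b d; rewrite -!mulmxA; apply/esym.
have lt_j := ltn_ord j.
apply: (braid_raise (tcoef_neq0 n r_neq0 s_neq0) Rh_braid (eps := eps K n j) (k := wE r s n j));
  rewrite ?ord_le //.
- by move=> b' d' _ _; apply: act_e_bvv.
- exact: eps_0.
- by move=> b'; apply: wE_neq0.
- by move=> b' le_b; apply: wE_rev.
- by move=> *; apply: alpha_raise.
- by move=> *; apply: beta_raise.
- by move=> *; apply: tcoef_raise.
Qed.

Lemma Rhat_f j : Rh *m act (f j) = act (f j) *m Rh.
Proof.
apply: eq_mx_bvv => b d; rewrite -!mulmxA; apply/esym.
have lt_j := ltn_ord j.
apply: (braid_lower (tcoef_neq0 n r_neq0 s_neq0) Rh_braid
  (phi := phi n (lowc j) (lowc' j) j) (k := wF r s n j)); rewrite ?ord_le //.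
- by move=> b' d' _ _; apply: act_f_bvv.
- exact: phi_max.
- by move=> b'; apply: wF_neq0.
- by move=> b' le_b; apply: wF_rev.
- by move=> b' d' le_b le_d; apply: alpha_lower.
- by move=> b' d' le_b le_d; apply: beta_lower.
- by move=> i; apply: tcoef_lower => //; apply: lowc_eq.
Qed.

(** Rhat preserves the total weight. The truncated sum occurs only for d = b', where the eigenvalue
    of D is 1, as it is on every v_i' (x) v_i. *)
Lemma braid_diag (k : nat -> K) (D : 'M[K]_(N * N)) :
  (forall b, k b != 0) -> (forall b, (b <= 2 * n)%N -> k (2 * n - b)%N = (k b)^-1) ->
  (forall b d, D *m bvv b d = (k b * k d) *: bvv b d) -> Rh *m D = D *m Rh.
Proof.
move=> k0 k_rev DE; apply: eq_mx_bvv => b d; rewrite -!mulmxA DE -scalemxAr.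
have le_b := ord_le b; have le_d := ord_le d.
rewrite Rh_braid // /braid_vec !mulmxDr mulmxN -!scalemxAr !DE !scalerDr scalerN.
congr (_ + _); first by congr (_ - _); rewrite !scalerA; congr (_ *: _); ring.
case: eqVneq => [e1|_]; last by rewrite mulr0 mul0r !scale0r scaler0.
rewrite e1 k_rev // mulfV // scale1r; congr (_ *: _).
rewrite /braid_sum mulmx_sumr; apply: eq_bigr => i _.
rewrite -scalemxAr DE k_rev ?mulVf ?scale1r //.
by apply: leq_trans le_b; apply: ltnW.
Qed.

Lemma Rhat_act u : Rh *m act u = act u *m Rh.
Proof.
(* For the inverses of omega_j and omega'_j: a one-sided inverse of a square matrix is two-sided, so
   commutation passes from [act x] to [act y]. *)
have inv x y : act x *m act y = 1%:M -> Rh *m act x = act x *m Rh ->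
    Rh *m act y = act y *m Rh.
  move=> xy Rx; have yx := mulmx1C xy.
  by rewrite -[RHS]mulmx1 -xy mulmxA -[_ *m Rh *m _]mulmxA Rx mulmxA yx mul1mx.
elim/U_ind: u => [g|c|x y IHx IHy|x y IHx IHy].
- case: g => j; [exact: Rhat_e|exact: Rhat_f| | | |].
  + apply: (braid_diag (k := wE r s n j)) => *; [exact: wE_neq0|exact: wE_rev|exact: act_w_bvv].
  + apply: (inv (w j)); first by rewrite -act_mul (rel_w (U_gen_relations r s n)) act_1.
    apply: (braid_diag (k := wE r s n j)) => *; [exact: wE_neq0|exact: wE_rev|exact: act_w_bvv].
  + apply: (braid_diag (k := wF r s n j)) => *; [exact: wF_neq0|exact: wF_rev|exact: act_wp_bvv].
  + apply: (inv (wp j)); first by rewrite -act_mul (rel_wp (U_gen_relations r s n)) act_1.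
    apply: (braid_diag (k := wF r s n j)) => *; [exact: wF_neq0|exact: wF_rev|exact: act_wp_bvv].
- by rewrite act_scale act_1 -scalemxAr -scalemxAl mulmx1 mul1mx.
- by rewrite act_add [LHS]mulmxDr [RHS]mulmxDl IHx IHy.
- by rewrite act_mul mulmxA IHx -mulmxA IHy mulmxA.
Qed.

End VectorRep.

(** * Words in the generators and graded components *)

Section GradedWords.
Variables (K : fieldType) (A : algType K) (I : eqType) (Q : zmodType).
Variables (g : I -> A) (deg : I -> Q).

Definition word (u : seq I) : A := \prod_(i <- u) g i.
Definition wdeg (u : seq I) : Q := \sum_(i <- u) deg i.

Lemma word_cons i u : word (i :: u) = g i * word u.
Proof. by rewrite /word big_cons. Qed.

Lemma word_cat u v : word (u ++ v) = word u * word v.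
Proof. by rewrite /word big_cat. Qed.

Lemma wdeg_cat u v : wdeg (u ++ v) = wdeg u + wdeg v.
Proof. by rewrite /wdeg big_cat. Qed.

Lemma gr_comp_word u : gr_comp g deg (wdeg u) (word u).
Proof.
elim: u => [|i u IH]; first by rewrite /wdeg /word !big_nil; constructor.
by rewrite /wdeg /word !big_cons; apply: Gr_mul => //; constructor.
Qed.

Lemma gr_comp_scale mu c x : gr_comp g deg mu x -> gr_comp g deg mu (c *: x).
Proof. by move=> gx; rewrite -[_ *: _]addr0; apply: Gr_lin => //; constructor. Qed.

Lemma gr_comp_sum (J : eqType) (l : seq J) (F : J -> A) mu :
  (forall q, q \in l -> gr_comp g deg mu (F q)) ->
  gr_comp g deg mu (\sum_(q <- l) F q).
Proof.
elim: l => [|q l IH] gF; first by rewrite big_nil; constructor.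
rewrite big_cons -[F q]scale1r; apply: Gr_lin; first by apply: gF; rewrite mem_head.
by apply: IH => q' q'l; apply: gF; rewrite inE q'l orbT.
Qed.

(** Words of degree mu take the place of a basis of the component. The words are linearly dependent
    in general, so the expression obtained is a choice. *)
Lemma gr_comp_span mu x : gr_comp g deg mu x ->
  exists l : seq (K * seq I), (forall q, q \in l -> wdeg q.2 = mu) /\
    x = \sum_(q <- l) q.1 *: word q.2.
Proof.
elim=> {mu x} [mu||i|mu c x y _ [l [l1 ->]] _ [l' [l'1 ->]]
  |mu nu x y _ [l [l1 ->]] _ [l' [l'1 ->]]].
- by exists [::]; rewrite big_nil.
- exists [:: (1, [::])]; rewrite big_seq1 scale1r /word big_nil; split=> // q.
  by rewrite inE => /eqP ->; rewrite /wdeg big_nil.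
- exists [:: (1, [:: i])]; rewrite big_seq1 scale1r /word big_seq1; split=> // q.
  by rewrite inE => /eqP ->; rewrite /wdeg big_seq1.
- exists ([seq (c * q.1, q.2) | q <- l] ++ l'); split=> [q|].
    by rewrite mem_cat => /orP[/mapP[q' /l1 ? ->]|/l'1].
  rewrite big_cat big_map /= scaler_sumr; congr (_ + _).
  by apply: eq_bigr => q _; rewrite scalerA.
exists [seq (q.1 * q'.1, q.2 ++ q'.2) | q <- l, q' <- l']; split=> [q|].
  by move=> /allpairsP[[q1 q2] /= [/l1 h1 /l'1 h2 ->]]; rewrite wdeg_cat h1 h2.
rewrite big_allpairs_dep mulr_suml; apply: eq_bigr => q _.
rewrite mulr_sumr; apply: eq_bigr => q' _.
by rewrite word_cat -scalerAl -scalerAr scalerA.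
Qed.

End GradedWords.

Section Splittings.
Variable (I : eqType).

(* The pairs (u, v) with w = u ++ j :: v. *)
Fixpoint splits (j : I) (w : seq I) : seq (seq I * seq I) :=
  if w is i :: w' then
    (if i == j then [:: ([::], w')] else [::])
    ++ [seq (i :: q.1, q.2) | q <- splits j w']
  else [::].

Lemma splits_mem j w q : q \in splits j w -> w = q.1 ++ j :: q.2.
Proof.
elim: w q => [|i w IH] q //=; rewrite mem_cat => /orP[|/mapP[q' /IH -> ->] //].
by case: eqP => [->|//]; rewrite inE => /eqP ->.
Qed.

Lemma big_splits_cons (V : nmodType) j i w (F : seq I -> seq I -> V) :
  \sum_(q <- splits j (i :: w)) F q.1 q.2 =
  (if i == j then F [::] w else 0) + \sum_(q <- splits j w) F (i :: q.1) q.2.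
Proof.
by rewrite /= big_cat big_map /=; case: eqP => _; rewrite ?big_seq1 ?big_nil.
Qed.

End Splittings.

(** * The pairing, the skew derivations and the intertwining relation degree by degree *)

Section Pairing.
Variables (K : fieldType) (r s : K) (n : nat).
Hypotheses (r_neq0 : r != 0) (s_neq0 : s != 0).
Local Notation U := (U r s n).
Local Notation e i := (Ugen r s (Ge i)).
Local Notation f i := (Ugen r s (Gf i)).
Local Notation w i := (Ugen r s (Gw i)).
Local Notation wp i := (Ugen r s (Gwp i)).
Local Notation chi := (@chi K r s n).
Variable Delta : U -> tensor U U.
Variable p : U -> U -> K.
Hypothesis Delta_cop : is_coproduct Delta.
Hypothesis p_pair : is_pairing Delta p.

Local Notation Ule := (@Ule K r s n).
Local Notation Uge := (@Uge K r s n).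

Definition Fw (u : seq 'I_n) : U := word (fun i : 'I_n => f i) u.
Definition Ew (u : seq 'I_n) : U := word (fun i : 'I_n => e i) u.

Lemma tens_mul (a b c d : U) : (tens a b : tensor U U) * tens c d = tens (a * c) (b * d).
Proof.
apply: tensor_ext => W h hb; rewrite (tlift_mul hb) (tlift_tens (bilin_sum hb _)).
by rewrite (tlift_tens (bilin_mulr hb _ _)) (tlift_tens hb).
Qed.

Lemma Delta1 : Delta 1 = tens 1 1.
Proof. exact: (coproduct_mul Delta_cop).1. Qed.

Lemma DeltaM x y : Delta (x * y) = Delta x * Delta y.
Proof. exact: (coproduct_mul Delta_cop).2. Qed.

Lemma Ule1 : Ule 1. Proof. exact: Subalg_one. Qed.
Lemma Uge1 : Uge 1. Proof. exact: Subalg_one. Qed.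
Lemma Ule_f i : Ule (f i). Proof. by apply: Subalg_gen; exists i; constructor 1. Qed.
Lemma Ule_wp i : Ule (wp i). Proof. by apply: Subalg_gen; exists i; constructor 2. Qed.
Lemma Uge_e i : Uge (e i). Proof. by apply: Subalg_gen; exists i; constructor 1. Qed.
Lemma Uge_w i : Uge (w i). Proof. by apply: Subalg_gen; exists i; constructor 2. Qed.
Lemma Ule_lin c x y : Ule x -> Ule y -> Ule (c *: x + y). Proof. exact: Subalg_lin. Qed.
Lemma Uge_lin c x y : Uge x -> Uge y -> Uge (c *: x + y). Proof. exact: Subalg_lin. Qed.
Lemma UleM x y : Ule x -> Ule y -> Ule (x * y). Proof. exact: Subalg_mul. Qed.
Lemma UgeM x y : Uge x -> Uge y -> Uge (x * y). Proof. exact: Subalg_mul. Qed.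
Hint Resolve Ule1 Uge1 Ule_f Ule_wp Uge_e Uge_w UleM UgeM : core.

Lemma Ule0 : Ule 0.
Proof. rewrite -[0](addNr (1 : U)) -scaleN1r; exact: Ule_lin. Qed.
Lemma Uge0 : Uge 0.
Proof. rewrite -[0](addNr (1 : U)) -scaleN1r; exact: Uge_lin. Qed.
Hint Resolve Ule0 Uge0 : core.

Lemma Uminus_Ule mu y : Uminus mu y -> Ule y.
Proof. by elim=> // *; [apply: Ule_lin | apply: UleM]. Qed.
Lemma Uplus_Uge mu x : Uplus mu x -> Uge x.
Proof. by elim=> // *; [apply: Uge_lin | apply: UgeM]. Qed.

Lemma Ule_F u : Ule (Fw u).
Proof. by elim: u => [|i u IH]; rewrite /Fw ?word_cons /word ?big_nil; auto. Qed.
Lemma Uge_E u : Uge (Ew u).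
Proof. by elim: u => [|i u IH]; rewrite /Ew ?word_cons /word ?big_nil; auto. Qed.
Hint Resolve Ule_F Uge_E : core.

Lemma pair0l x : Uge x -> p 0 x = 0.
Proof.
move=> x_ge; have := pairing_linl p_pair (- 1) Ule1 Ule1 x_ge.
by rewrite scaleN1r addNr mulN1r addNr.
Qed.

Lemma pair0r y : Ule y -> p y 0 = 0.
Proof.
move=> y_le; have := pairing_linr p_pair (- 1) y_le Uge1 Uge1.
by rewrite scaleN1r addNr mulN1r addNr.
Qed.

Lemma pairZl c y x : Ule y -> Uge x -> p (c *: y) x = c * p y x.
Proof.
move=> y_le x_ge; have := pairing_linl p_pair c y_le Ule0 x_ge.
by rewrite addr0 pair0l // addr0.
Qed.

Lemma Ule_sum (J : Type) (l : seq J) (c : J -> K) (F : J -> U) :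
  (forall q, Ule (F q)) -> Ule (\sum_(q <- l) c q *: F q).
Proof.
by move=> F_le; elim: l => [|q l IH]; rewrite ?big_nil ?big_cons //; apply: Ule_lin.
Qed.

Lemma Uge_sum (J : Type) (l : seq J) (c : J -> K) (F : J -> U) :
  (forall q, Uge (F q)) -> Uge (\sum_(q <- l) c q *: F q).
Proof.
by move=> F_ge; elim: l => [|q l IH]; rewrite ?big_nil ?big_cons //; apply: Uge_lin.
Qed.

Lemma pair_suml (J : Type) (l : seq J) (c : J -> K) (F : J -> U) x :
  (forall q, Ule (F q)) -> Uge x ->
  p (\sum_(q <- l) c q *: F q) x = \sum_(q <- l) c q * p (F q) x.
Proof.
move=> F_le x_ge; elim: l => [|q l IH]; first by rewrite !big_nil pair0l.
rewrite !big_cons (pairing_linl p_pair) ?IH //; exact: Ule_sum.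
Qed.

Lemma pair_sumr (J : Type) (l : seq J) (c : J -> K) (F : J -> U) y :
  (forall q, Uge (F q)) -> Ule y ->
  p y (\sum_(q <- l) c q *: F q) = \sum_(q <- l) c q * p y (F q).
Proof.
move=> F_ge y_le; elim: l => [|q l IH]; first by rewrite !big_nil pair0r.
rewrite !big_cons (pairing_linr p_pair) ?IH //; exact: Uge_sum.
Qed.

Lemma omega0 : omega r s (fun=> 0) = 1 :> U.
Proof. by rewrite /omega big1. Qed.
Lemma omegap0 : omegap r s (fun=> 0) = 1 :> U.
Proof. by rewrite /omegap big1. Qed.
Lemma omega1 (i : 'I_n) : omega r s (fun k => (k == i)%:Z) = w i.
Proof.
rewrite /omega (eq_bigr (fun k => if k == i then w k else 1)) => [|k _].
  by rewrite -big_mkcond (big_pred1 i).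
by case: eqP => //= _; rewrite expr1.
Qed.
Lemma omegap1 (i : 'I_n) : omegap r s (fun k => (k == i)%:Z) = wp i.
Proof.
rewrite /omegap (eq_bigr (fun k => if k == i then wp k else 1)) => [|k _].
  by rewrite -big_mkcond (big_pred1 i).
by case: eqP => //= _; rewrite expr1.
Qed.
Lemma root_comb0 : root_comb (fun=> 0) = 0 :> rlat n.
Proof. by rewrite /root_comb big1. Qed.
Lemma root_comb1 (i : 'I_n) : root_comb (fun k => (k == i)%:Z) = alpha i.
Proof.
rewrite /root_comb (bigD1 i) //= eqxx mulr1z big1 ?addr0 // => k /negPf ->.
by rewrite mulr0z.
Qed.

Lemma pair11 : p 1 1 = 1.
Proof.
by have := pairing_ww p_pair (fun=> 0) (fun=> 0); rewrite omega0 omegap0 root_comb0 chi0l.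
Qed.
Lemma pair_wp1 i : p (wp i) 1 = 1.
Proof.
have := pairing_ww p_pair (fun k => (k == i)%:Z) (fun=> 0).
by rewrite omega0 omegap1 root_comb0 chi0r.
Qed.
Lemma pair_wpw i j : p (wp i) (w j) = chi (alpha i) (alpha j).
Proof.
have := pairing_ww p_pair (fun k => (k == i)%:Z) (fun k => (k == j)%:Z).
by rewrite omega1 omegap1 !root_comb1.
Qed.

Lemma pair_mul1 y y' : Ule y -> Ule y' -> p (y * y') 1 = p y 1 * p y' 1.
Proof.
move=> y_le y'_le.
rewrite (pairing_mull p_pair (ab := [:: (1, 1)])) ?big_seq1 //.
- by move=> q; rewrite inE => /eqP ->; split=> /=.
by rewrite Delta1.
Qed.

Lemma pair_mule y y' j : Ule y -> Ule y' ->
  p (y * y') (e j) = p y (e j) * p y' 1 + p y (w j) * p y' (e j).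
Proof.
move=> y_le y'_le.
rewrite (pairing_mull p_pair (ab := [:: (e j, 1); (w j, e j)])) //.
- by rewrite big_cons big_seq1.
- by move=> q; rewrite !inE => /orP[] /eqP ->; split=> /=.
by rewrite (coproduct_e Delta_cop) big_cons big_seq1.
Qed.

(** Not an axiom of the pairing: expanding (w'_j 1, e_j) = 0 with the coproduct of e_j leaves (w'_j,
    w_j) (1, e_j), whose first factor is invertible. *)
Lemma pair1e j : p 1 (e j) = 0.
Proof.
have := pair_mule j (Ule_wp j) Ule1.
rewrite mulr1 (pairing_we p_pair) mul0r add0r pair_wpw => /esym/eqP.
by rewrite mulf_eq0 (negPf (chi_neq0 r_neq0 s_neq0 _ _)) => /eqP.
Qed.

Lemma pair_f1 i : p (f i) 1 = 0.
Proof.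
have : p (f i) (w i * 1) = p 1 1 * p (f i) (w i) + p (f i) 1 * p (wp i) (w i).
  rewrite (pairing_mulr p_pair (ab := [:: (1, f i); (f i, wp i)])) //.
  - by rewrite big_cons big_seq1.
  - by move=> q; rewrite !inE => /orP[] /eqP ->; split=> /=.
  by rewrite (coproduct_f Delta_cop) big_cons big_seq1.
rewrite mulr1 (pairing_fw p_pair) mulr0 add0r pair_wpw => /esym/eqP.
by rewrite mulf_eq0 (negPf (chi_neq0 r_neq0 s_neq0 _ _)) orbF => /eqP.
Qed.

Lemma pair_fM1 i b : Ule b -> p (f i * b) 1 = 0.
Proof. by move=> b_le; rewrite pair_mul1 // pair_f1 mul0r. Qed.
Lemma pair_wpM1 i b : Ule b -> p (wp i * b) 1 = p b 1.
Proof. by move=> b_le; rewrite pair_mul1 // pair_wp1 mul1r. Qed.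
Lemma pair_fMe i j b : Ule b ->
  p (f i * b) (e j) = if i == j then p (f j) (e j) * p b 1 else 0.
Proof.
move=> b_le; rewrite pair_mule // (pairing_fw p_pair) mul0r addr0.
by case: eqP => [->|/eqP/negPf ij] //; rewrite (pairing_fe p_pair) ij !mul0r.
Qed.
Lemma pair_wpMe i j b : Ule b -> p (wp i * b) (e j) = chi (alpha i) (alpha j) * p b (e j).
Proof. by move=> b_le; rewrite pair_mule // (pairing_we p_pair) mul0r add0r pair_wpw. Qed.

Lemma pair_wpM i x x' : Uge x -> Uge x' -> p (wp i) (x * x') = p (wp i) x' * p (wp i) x.
Proof.
move=> x_ge x'_ge.
rewrite (pairing_mulr p_pair (ab := [:: (wp i, wp i)])) ?big_seq1 //.
- by move=> q; rewrite inE => /eqP ->; split=> /=.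
by rewrite (coproduct_wp Delta_cop).
Qed.

(** The axioms of the pairing ask for a list of pairs representing a coproduct. The coproduct of a
    word is multiplied out letter by letter, which keeps every entry in U^<=, respectively U^>= for
    [copE]. *)
Fixpoint copF (u : seq 'I_n) : seq (U * U) :=
  if u is i :: u' then
    [seq (q.1, f i * q.2) | q <- copF u'] ++ [seq (f i * q.1, wp i * q.2) | q <- copF u']
  else [:: (1, 1)].

Fixpoint copE (u : seq 'I_n) : seq (U * U) :=
  if u is i :: u' then
    [seq (e i * q.1, q.2) | q <- copE u'] ++ [seq (w i * q.1, e i * q.2) | q <- copE u']
  else [:: (1, 1)].

Lemma Delta_F u : Delta (Fw u) = \sum_(q <- copF u) tens q.1 q.2.
Proof.
elim: u => [|i u IH]; first by rewrite /Fw /word big_nil Delta1 big_seq1.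
rewrite /Fw word_cons DeltaM -/(Fw u) IH (coproduct_f Delta_cop) mulrDl big_cat !big_map.
by congr (_ + _); rewrite mulr_sumr; apply: eq_bigr => q _; rewrite tens_mul ?mul1r.
Qed.

Lemma Delta_E u : Delta (Ew u) = \sum_(q <- copE u) tens q.1 q.2.
Proof.
elim: u => [|i u IH]; first by rewrite /Ew /word big_nil Delta1 big_seq1.
rewrite /Ew word_cons DeltaM -/(Ew u) IH (coproduct_e Delta_cop) mulrDl big_cat !big_map.
by congr (_ + _); rewrite mulr_sumr; apply: eq_bigr => q _; rewrite tens_mul ?mul1r.
Qed.

Lemma copF_le u : in_pairs Ule (copF u).
Proof.
elim: u => [|i u IH] q /=; first by rewrite inE => /eqP ->; split=> /=.
by rewrite mem_cat => /orP[] /mapP[q' /IH[? ?] ->]; split=> /=; auto.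
Qed.

Lemma copE_ge u : in_pairs Uge (copE u).
Proof.
elim: u => [|i u IH] q /=; first by rewrite inE => /eqP ->; split=> /=.
by rewrite mem_cat => /orP[] /mapP[q' /IH[? ?] ->]; split=> /=; auto.
Qed.

Definition chiL (j : 'I_n) (u : seq 'I_n) : K := \prod_(i <- u) chi (alpha i) (alpha j).
Definition chiR (j : 'I_n) (u : seq 'I_n) : K := \prod_(i <- u) chi (alpha j) (alpha i).

(** On words (-, 1) acts as the counit. The function h is arbitrary so that the induction can absorb
    the letters of the other tensor factor into it. *)
Lemma sum_copF1r u (h : U -> K) : \sum_(q <- copF u) h q.1 * p q.2 1 = h (Fw u).
Proof.
elim: u h => [|i u IH] h; first by rewrite big_seq1 pair11 mulr1 /Fw /word big_nil.
rewrite big_cat !big_map /= big1_seq => [|q /andP[_ /copF_le[_ q_le]]].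
  rewrite add0r /Fw word_cons -(IH (fun z => h (f i * z))) big_seq [RHS]big_seq.
  by apply: eq_bigr => q /copF_le[_ q_le]; rewrite pair_wpM1.
by rewrite pair_fM1 // mulr0.
Qed.

Lemma sum_copF1l u (h : U -> K) : \sum_(q <- copF u) p q.1 1 * h q.2 = h (Fw u).
Proof.
elim: u h => [|i u IH] h; first by rewrite big_seq1 pair11 mul1r /Fw /word big_nil.
rewrite big_cat !big_map /= [X in _ + X]big1_seq => [|q /andP[_ /copF_le[q_le _]]].
  by rewrite addr0 /Fw word_cons -(IH (fun z => h (f i * z))).
by rewrite pair_fM1 // mul0r.
Qed.

(** (-, e_j) selects the terms whose second factor contains a single letter f, namely f_j. Each
    letter i before it leaves w'_i in the second factor and so the scalar (w'_i, w_j); later letters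
    leave (w'_i, 1) = 1. *)
Lemma sum_copFer u j (h : U -> K) : \sum_(q <- copF u) h q.1 * p q.2 (e j) =
  p (f j) (e j) * \sum_(q <- splits j u) chiL j q.1 * h (Fw q.1 * Fw q.2).
Proof.
elim: u h => [|i u IH] h; first by rewrite big_seq1 pair1e mulr0 big_nil mulr0.
rewrite (big_splits_cons j i u (fun u v => chiL j u * h (Fw u * Fw v))).
rewrite big_cat !big_map /= mulrDr; congr (_ + _).
  rewrite (eq_big_seq (fun q => (if i == j then p (f j) (e j) else 0) * (h q.1 * p q.2 1))).
    rewrite -mulr_sumr sum_copF1r /chiL big_nil mul1r {2}/Fw /word big_nil mul1r.
    by case: eqP; rewrite ?mul0r ?mulr0.
  move=> q /copF_le[_ q_le]; rewrite pair_fMe //.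
  by case: eqP => _; rewrite ?mul0r ?mulr0 // mulrCA.
rewrite (eq_big_seq (fun q => chi (alpha i) (alpha j) * (h (f i * q.1) * p q.2 (e j)))).
  rewrite -mulr_sumr (IH (fun z => h (f i * z))) mulrCA; congr (_ * _).
  rewrite mulr_sumr; apply: eq_bigr => q _.
  by rewrite /chiL big_cons mulrA {3}/Fw word_cons mulrA.
by move=> q /copF_le[_ q_le]; rewrite pair_wpMe // mulrCA.
Qed.

(** Now the first factor must be f_j alone, and the chosen letter leaves w'_j in its place among the
    remaining letters of the second factor. *)
Lemma sum_copFel u j (h : U -> K) : \sum_(q <- copF u) p q.1 (e j) * h q.2 =
  p (f j) (e j) * \sum_(q <- splits j u) h (Fw q.1 * (wp j * Fw q.2)).
Proof.
elim: u h => [|i u IH] h; first by rewrite big_seq1 pair1e mul0r big_nil mulr0.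
rewrite (big_splits_cons j i u (fun u v => h (Fw u * (wp j * Fw v)))).
rewrite big_cat !big_map /= mulrDr addrC; congr (_ + _).
  rewrite (eq_big_seq (fun q =>
    (if i == j then p (f j) (e j) else 0) * (p q.1 1 * h (wp j * q.2)))).
    rewrite -mulr_sumr (sum_copF1l _ (fun z => h (wp j * z))) {2}/Fw /word big_nil mul1r.
    by case: eqP; rewrite ?mul0r ?mulr0.
  move=> q /copF_le[q_le _]; rewrite pair_fMe //.
  by case: eqP => [->|_]; rewrite ?mul0r ?mulr0 // mulrA.
rewrite (IH (fun z => h (f i * z))); congr (_ * _); apply: eq_bigr => q _.
by rewrite {3}/Fw word_cons mulrA.
Qed.

Lemma sum_copE_wp u j (h : U -> K) : \sum_(q <- copE u) h q.1 * p (wp j) q.2 = h (Ew u).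
Proof.
elim: u h => [|i u IH] h; first by rewrite big_seq1 pair_wp1 mulr1 /Ew /word big_nil.
rewrite big_cat !big_map /= [X in _ + X]big1_seq => [|q /andP[_ /copE_ge[_ q_ge]]].
  by rewrite addr0 /Ew word_cons -(IH (fun z => h (e i * z))).
by rewrite pair_wpM // (pairing_we p_pair) mulr0 mulr0.
Qed.

(** In the coproduct of a word in the e_i only the term with second factor 1 pairs nontrivially with
    w'_j. Hence the w'_j left over when f_j is split off, once moved to the right end, is invisible
    to U^+. *)
Lemma pair_M_wp y j u : Ule y -> p (y * wp j) (Ew u) = p y (Ew u).
Proof.
move=> y_le; rewrite (pairing_mull p_pair (ab := copE u)) //.
- exact: sum_copE_wp.
- exact: copE_ge.
exact: Delta_E.
Qed.

Lemma w_F j u : Fw u * w j = chiL j u *: (w j * Fw u).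
Proof.
elim: u => [|i u IH].
  by rewrite /Fw /word /chiL !big_nil mul1r mulr1 scale1r.
rewrite /Fw word_cons -/(Fw u) /chiL big_cons -/(chiL j u) -mulrA IH -scalerAr !mulrA.
rewrite (rel_wf (U_gen_relations r s n) j i) -scalerAl scalerA mulrAC.
rewrite (_ : chi (alpha i) (alpha j) * _ = 1) ?mul1r //.
rewrite /Defs.chi mulrACA -!expfzDr // subrr addNr !expr0z mulr1 //.
Qed.

Lemma wp_F j u : wp j * Fw u = chiR j u *: (Fw u * wp j).
Proof.
elim: u => [|i u IH].
  by rewrite /Fw /word /chiR !big_nil mul1r mulr1 scale1r.
rewrite /Fw word_cons -/(Fw u) /chiR big_cons -/(chiR j u) mulrA.
by rewrite (rel_wpf (U_gen_relations r s n) j i) -scalerAl -mulrA IH -scalerAr scalerA mulrA.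
Qed.

(* The skew derivations of U^-, adjoint to the multiplications by e_j on the
   left and on the right. *)
Definition dL (j : 'I_n) (u : seq 'I_n) : U :=
  \sum_(q <- splits j u) chiL j q.1 *: (Fw q.1 * Fw q.2).
Definition dR (j : 'I_n) (u : seq 'I_n) : U :=
  \sum_(q <- splits j u) chiR j q.2 *: (Fw q.1 * Fw q.2).

Lemma pair_F_eM u j x : Uge x -> p (Fw u) (e j * x) = p (f j) (e j) * p (dL j u) x.
Proof.
move=> x_ge; rewrite (pairing_mulr p_pair (ab := copF u)) //.
- by rewrite (sum_copFer u j (fun z => p z x)) /dL pair_suml //; auto.
- exact: copF_le.
exact: Delta_F.
Qed.

Lemma pair_F_Me u j v : p (Fw u) (Ew v * e j) = p (f j) (e j) * p (dR j u) (Ew v).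
Proof.
rewrite (pairing_mulr p_pair (ab := copF u)) //.
- rewrite (sum_copFel u j (fun z => p z (Ew v))) /dR pair_suml //; last by auto.
  congr (_ * _); apply: eq_bigr => q _.
  by rewrite wp_F -scalerAr pairZl ?mulrA ?pair_M_wp //; auto.
- exact: copF_le.
exact: Delta_F.
Qed.

(** When e_j is moved past the letters one at a time, each letter f_j leaves w_j - w'_j in its
    place. Moving w_j to the left end and w'_j to the right end produces exactly the scalars of [dL]
    and [dR]. *)
Lemma comm_e_F u j : e j * Fw u - Fw u * e j =
  (rr r j - ss s j)^-1 *: (w j * dL j u - dR j u * wp j).
Proof.
have -> : e j * Fw u - Fw u * e j = (rr r j - ss s j)^-1 *:
    \sum_(q <- splits j u) (Fw q.1 * (w j - wp j) * Fw q.2).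
  elim: u => [|i u IH]; first by rewrite big_nil scaler0 /Fw /word big_nil mul1r mulr1 subrr.
  rewrite (big_splits_cons j i u (fun u v => Fw u * (w j - wp j) * Fw v)) scalerDr.
  transitivity ((e j * f i - f i * e j) * Fw u + f i * (e j * Fw u - Fw u * e j)).
    rewrite {1 2}/Fw !word_cons mulrBl mulrBr -!/(Fw _) !mulrA.
    by rewrite addrA subrK.
  rewrite (rel_ef (U_gen_relations r s n) j i) IH; congr (_ + _).
    rewrite eq_sym {2}/Fw /word big_nil mul1r; case: eqP => _.
      by rewrite mul1r -scalerAl.
    by rewrite mul0r scale0r mul0r scaler0.
  rewrite -scalerAr mulr_sumr; congr (_ *: _); apply: eq_bigr => q _.
  by rewrite {3}/Fw word_cons !mulrA.
congr (_ *: _); rewrite /dL /dR mulr_sumr mulr_suml -sumrB; apply: eq_bigr => q _.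
rewrite mulrBr mulrBl w_F -[Fw _ * wp j * _]mulrA wp_F.
by rewrite -!scalerAl -!scalerAr !mulrA.
Qed.

Lemma dual_expand_minus mu m (y x : 'I_m -> U) z :
  dual_bases p mu y x -> Uminus (- mu) z -> z = \sum_k p z (x k) *: y k.
Proof.
move=> [[y_in y_gen] [x_in _] yx] z_in; have [c [cz _]] := y_gen z z_in.
rewrite {1}cz; apply: eq_bigr => k _; congr (_ *: _).
have x_ge : Uge (x k) by apply: Uplus_Uge (x_in k).
rewrite cz pair_suml => [|i|] //; last exact: Uminus_Ule (y_in i).
by rewrite (bigD1 k) //= yx eqxx mulr1 big1 ?addr0 // => i /negPf ik; rewrite yx ik mulr0.
Qed.

Lemma dual_expand_plus mu m (y x : 'I_m -> U) z :
  dual_bases p mu y x -> Uplus mu z -> z = \sum_k p (y k) z *: x k.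
Proof.
move=> [[y_in _] [x_in x_gen] yx] z_in; have [c [cz _]] := x_gen z z_in.
rewrite {1}cz; apply: eq_bigr => k _; congr (_ *: _).
have y_le : Ule (y k) by apply: Uminus_Ule (y_in k).
rewrite cz pair_sumr => [|i|] //; last exact: Uplus_Uge (x_in i).
rewrite (bigD1 k) //= yx eqxx mulr1 big1 ?addr0 // => i /negPf ik.
by rewrite yx eq_sym ik mulr0.
Qed.

Lemma Uminus_splits (c : seq 'I_n -> seq 'I_n -> K) j u :
  Uminus (wdeg (fun i : 'I_n => - alpha i) u + alpha j)
    (\sum_(q <- splits j u) c q.1 q.2 *: (Fw q.1 * Fw q.2)).
Proof.
apply: gr_comp_sum => q /splits_mem ->; apply: gr_comp_scale.
rewrite /Fw -word_cat (_ : _ + _ = wdeg (fun i : 'I_n => - alpha i) (q.1 ++ q.2)).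
  exact: gr_comp_word.
by rewrite !wdeg_cat {2}/wdeg big_cons -/(wdeg _ _) addrA addrAC subrK.
Qed.

Lemma pair_fe_opp j : p (f j) (e j) = - (rr r j - ss s j)^-1.
Proof. by rewrite (pairing_fe p_pair) eqxx mul1r -invrN opprB. Qed.

(** [yL] and [yR] are built from a chosen expression of y in words, hence the existential form. The
    pairings in the last clause recover their coordinates in any basis with a dual. *)
Lemma minus_deriv j mu y : Uminus (- mu) y -> exists yL yR : U,
  [/\ Uminus (- (mu - alpha j)) yL, Uminus (- (mu - alpha j)) yR,
    e j * y - y * e j = (rr r j - ss s j)^-1 *: (w j * yL - yR * wp j) &
    forall x, Uplus (mu - alpha j) x ->
      p y (e j * x) = - (rr r j - ss s j)^-1 * p yL x /\
      p y (x * e j) = - (rr r j - ss s j)^-1 * p yR x].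
Proof.
move=> /gr_comp_span[l [l_deg ->]].
exists (\sum_(q <- l) q.1 *: dL j q.2), (\sum_(q <- l) q.1 *: dR j q.2).
have le_dL u : Ule (dL j u) by apply: Ule_sum; auto.
have le_dR u : Ule (dR j u) by apply: Ule_sum; auto.
split.
- apply: gr_comp_sum => q /l_deg h; apply: gr_comp_scale.
  by rewrite opprB addrC -h; apply: Uminus_splits (fun u _ => chiL j u) _ _.
- apply: gr_comp_sum => q /l_deg h; apply: gr_comp_scale.
  by rewrite opprB addrC -h; apply: Uminus_splits (fun _ u => chiR j u) _ _.
- rewrite !mulr_sumr !mulr_suml -!sumrB scaler_sumr; apply: eq_bigr => q _.
  by rewrite -!scalerAl -!scalerAr -!scalerBr scalerA mulrC -scalerA -comm_e_F.
move=> x x_in; rewrite -pair_fe_opp; have x_ge := Uplus_Uge x_in.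
have F_le (q : K * seq 'I_n) : Ule (word (fun i : 'I_n => f i) q.2) by apply: Ule_F.
split.
  rewrite !pair_suml //; auto.
  by rewrite mulr_sumr; apply: eq_bigr => q _; rewrite (pair_F_eM _ _ x_ge) mulrCA.
have [l' [_ ->]] := gr_comp_span x_in.
have -> : (\sum_(q <- l') q.1 *: word (fun i : 'I_n => e i) q.2) * e j =
    \sum_(q <- l') q.1 *: (Ew q.2 * e j).
  by rewrite mulr_suml; apply: eq_bigr => q _; rewrite -scalerAl.
have E_ge (q : K * seq 'I_n) : Uge (word (fun i : 'I_n => e i) q.2) by apply: Uge_E.
rewrite !pair_sumr //; auto; [|exact: Ule_sum|exact: Ule_sum].
rewrite mulr_sumr; apply: eq_bigr => q' _; rewrite mulrCA; congr (_ * _).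
rewrite !pair_suml //; auto.
by rewrite mulr_sumr; apply: eq_bigr => q _; rewrite pair_F_Me mulrCA.
Qed.

(** The constant of the commutator is minus (f_j, e_j), so it turns pairings with [yL] and [yR] into
    plain pairings with y, with the signs of the two terms exchanged. *)
Lemma comm_expand j mu m (y' x' : 'I_m -> U) y :
  dual_bases p (mu - alpha j) y' x' -> Uminus (- mu) y ->
  e j * y - y * e j = \sum_k (p y (x' k * e j) *: (y' k * wp j)
                              - p y (e j * x' k) *: (w j * y' k)).
Proof.
move=> D /(minus_deriv j)[yL [yR [yL_in yR_in -> Hp]]].
rewrite {1}(dual_expand_minus D yL_in) {1}(dual_expand_minus D yR_in).
have [_ [x_in _] _] := D.
rewrite mulr_sumr mulr_suml -sumrB scaler_sumr; apply: eq_bigr => k _.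
have [-> ->] := Hp _ (x_in k).
by rewrite -scalerAl -scalerAr scalerBr !scalerA !mulNr !scaleNr opprK addrC.
Qed.

(** Once [e_j, y_i] is expanded in the y'_k, the sum over i collects the x_i with coefficients (y_i,
    x'_k e_j) and (y_i, e_j x'_k); by duality in degree mu these sums are x'_k e_j and e_j x'_k. *)
Lemma Theta_mu_e N (rho : {lrmorphism U -> 'M[K]_N.+1}) j mu m (y x : 'I_m -> U)
    m' (y' x' : 'I_m' -> U) :
  dual_bases p mu y x -> dual_bases p (mu - alpha j) y' x' ->
  (rho (e j) *t 1%:M) *m (\sum_i rho (y i) *t rho (x i))
  - (\sum_i rho (y i) *t rho (x i)) *m (rho (e j) *t 1%:M) =
  (\sum_i rho (y' i) *t rho (x' i)) *m (rho (wp j) *t rho (e j))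
  - (rho (w j) *t rho (e j)) *m (\sum_i rho (y' i) *t rho (x' i)).
Proof.
move=> D D'.
have rhoZ c z : rho (c *: z) = c *: rho z by rewrite linearZ.
have tl M (I : Type) (l : seq I) (c : I -> K) (F : I -> 'M[K]_N.+1) :
    (\sum_(k <- l) c k *: F k) *t M = \sum_(k <- l) c k *: (F k *t M) :> 'M[K]_(_, _).
  elim: l => [|k l IH]; first by rewrite !big_nil tens0mx.
  by rewrite !big_cons tens_linear_l IH.
have tr M (I : Type) (l : seq I) (c : I -> K) (F : I -> 'M[K]_N.+1) :
    M *t (\sum_(k <- l) c k *: F k) = \sum_(k <- l) c k *: (M *t F k) :> 'M[K]_(_, _).
  elim: l => [|k l IH]; first by rewrite !big_nil tensmx0.
  by rewrite !big_cons tens_linear_r IH.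
have tB (A B M : 'M[K]_N.+1) : (A - B) *t M = A *t M - B *t M.
  by rewrite -scaleN1r addrC tens_linear_l scaleN1r addrC.
have [[y_in _] [x_in _] _] := D; have [_ [x'_in _] _] := D'.
rewrite !mulmx_sumr !mulmx_suml -!sumrB.
transitivity (\sum_i (\sum_k p (y i) (x' k * e j) *: (rho (y' k * wp j) *t rho (x i))
   - \sum_k p (y i) (e j * x' k) *: (rho (w j * y' k) *t rho (x i)))).
  apply: eq_bigr => i _; rewrite !tensmx_mul !mul1mx !mulmx1 -tB.
  rewrite !mulmxE -!rmorphM -rmorphB (comm_expand D' (y_in i)) sumrB rmorphB tB.
  by congr (_ - _); rewrite -tl rmorph_sum; congr (_ *t _); apply: eq_bigr => k _; apply: rhoZ.
rewrite !sumrB; congr (_ - _); rewrite exchange_big; apply: eq_bigr => k _ /=.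
  rewrite -tr !tensmx_mul !mulmxE -!rmorphM; congr (_ *t _).
  have x'e : Uplus mu (x' k * e j).
    by rewrite -[mu](subrK (alpha j)); apply: Gr_mul; [exact: x'_in | exact: Gr_gen].
  rewrite [in RHS](dual_expand_plus D x'e) [RHS]rmorph_sum.
  by apply: eq_bigr => i _; apply/esym/rhoZ.
rewrite -tr !tensmx_mul !mulmxE -!rmorphM; congr (_ *t _).
have ex' : Uplus mu (e j * x' k).
  by rewrite -[mu](subrK (alpha j)) addrC; apply: Gr_mul; [exact: Gr_gen | exact: x'_in].
rewrite [in RHS](dual_expand_plus D ex') [RHS]rmorph_sum.
by apply: eq_bigr => i _; apply/esym/rhoZ.
Qed.

End Pairing.

(** * Graded components of degree 0 and of degrees that no word has *)

Section SmallComponents.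
Variables (K : fieldType) (A : algType K) (I : eqType) (Q : zmodType).
Variables (g : I -> A) (deg : I -> Q).

Lemma is_basis_unit : (forall u, wdeg deg u = 0 -> u = [::]) ->
  is_basis (gr_comp g deg 0) (fun _ : 'I_1 => 1).
Proof.
move=> deg0; split=> [_|z /gr_comp_span[l [l_deg ->]]]; first exact: Gr_one.
have -> : \sum_(q <- l) q.1 *: word g q.2 = (\sum_(q <- l) q.1) *: 1.
  rewrite scaler_suml; apply: eq_big_seq => q /l_deg /deg0 ->.
  by rewrite /word big_nil.
exists [ffun=> \sum_(q <- l) q.1]; split; first by rewrite big_ord1 ffunE.
move=> c /eqP; rewrite big_ord1 -subr_eq0 -scalerBl scaler_eq0 oner_eq0 orbF subr_eq0.
by move=> /eqP h; apply/ffunP => i; rewrite ffunE ord1.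
Qed.

Lemma is_basis_empty mu (b : 'I_0 -> A) : (forall u, wdeg deg u <> mu) ->
  is_basis (gr_comp g deg mu) b.
Proof.
move=> no_deg; split=> [[] //|z /gr_comp_span[[|q l] [l_deg ->]]]; last first.
  by case: (no_deg q.2); apply: l_deg; rewrite mem_head.
exists [ffun=> 0]; split; first by rewrite big_nil big_ord0.
by move=> c _; apply/ffunP => -[].
Qed.

End SmallComponents.

(** * Heights of weights *)

Section Height.
Variable n : nat.
Local Notation N := (2 * n).+1%N.

(* The height, written so that [ht (eps_(k+1)) = n - k]. *)
Definition ht (mu : rlat n) : int := \sum_i mu 0 i * (n%:Z - i%:Z).

Lemma ht0 : ht 0 = 0.
Proof. by rewrite /ht big1 // => i _; rewrite mxE mul0r. Qed.

Lemma htD : {morph ht : x y / x + y}.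
Proof.
by move=> x y; rewrite /ht -big_split; apply: eq_bigr => i _; rewrite mxE mulrDl.
Qed.

Lemma htN x : ht (- x) = - ht x.
Proof. by apply: (addrI (ht x)); rewrite -htD !subrr ht0. Qed.

Lemma ht_wtn k : (k <= 2 * n)%N -> ht (wtn n k) = n%:Z - k%:Z.
Proof.
move: k; apply: fold_index => [k lt_k||k lt_k].
- rewrite (wtn_delta (Ordinal lt_k)) /ht (bigD1 (Ordinal lt_k)) //= big1 => [|i ne].
    by rewrite mxE !eqxx mul1r addr0.
  by rewrite mxE (negPf ne) mul0r.
- by rewrite wtn_mid ht0 subrr.
rewrite wtn_rev; last lia.
rewrite htN (wtn_delta (Ordinal lt_k)) /ht (bigD1 (Ordinal lt_k)) //= big1 => [|i ne].
  by rewrite mxE !eqxx mul1r addr0; lia.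
by rewrite mxE (negPf ne) mul0r.
Qed.

Lemma ht_alpha j : ht (alpha j) = 1.
Proof.
by rewrite alpha_wtn htD htN !ht_wtn; have := ltn_ord j; lia.
Qed.

Lemma ht_wdeg u : ht (wdeg (@alpha n) u) = (size u)%:Z.
Proof.
elim: u => [|i u IH]; first by rewrite /wdeg big_nil ht0.
by rewrite /wdeg big_cons htD -/(wdeg _ _) IH ht_alpha.
Qed.

Lemma wdeg_opp u : wdeg (fun i : 'I_n => - alpha i) u = - wdeg (@alpha n) u.
Proof. by rewrite /wdeg sumrN. Qed.

Lemma wdeg_eq0 u : wdeg (@alpha n) u = 0 -> u = [::].
Proof. by move=> /(congr1 ht); rewrite ht_wdeg ht0; case: u. Qed.

Lemma wdeg_pos u : wdeg (@alpha n) u != 0 -> rlat_pos (wdeg (@alpha n) u).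
Proof.
move=> u0; split=> //; exists (fun i => count_mem i u).
elim: u {u0} => [|i u IH]; first by rewrite /wdeg big_nil /root_comb big1.
rewrite /wdeg big_cons -/(wdeg _ _) IH -(root_comb1 i) /root_comb -big_split.
by apply: eq_bigr => k _ /=; rewrite -mulrzDr PoszD eq_sym.
Qed.

Lemma ht_pos mu : rlat_pos mu -> 0 < ht mu.
Proof.
move=> [mu0 [k muE]].
have htE : ht mu = (\sum_i k i)%N%:Z.
  rewrite muE /root_comb (big_morph ht htD ht0) (big_morph Posz PoszD (erefl _)).
  apply: eq_bigr => i _.
  elim: (k i) => [|m IH]; first by rewrite mulr0z ht0.
  by rewrite intS mulrzDr htD IH mulr1z ht_alpha.
rewrite htE ltz_nat lt0n; apply: contra mu0 => /eqP k0; rewrite muE.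
rewrite /root_comb big1 // => i _; move: k0; rewrite (bigD1 i) //= => /eqP.
by rewrite addn_eq0 => /andP[/eqP -> _]; rewrite mulr0z.
Qed.

End Height.

(** * Theta on V (x) V and the comparison of R with Rhat *)

Section Main.
Variables (K : fieldType) (r s : K) (n : nat).
Hypotheses (r_neq0 : r != 0) (s_neq0 : s != 0).
Local Notation N := (2 * n).+1%N.
Local Notation bv := (bv K n).
Local Notation bvv := (bvv K n).
Local Notation U := (U r s n).
Local Notation e i := (Ugen r s (Ge i)).
Local Notation f i := (Ugen r s (Gf i)).
Local Notation w i := (Ugen r s (Gw i)).
Local Notation wp i := (Ugen r s (Gwp i)).
Variable rho : {lrmorphism U -> 'M[K]_N}.
Hypothesis rho_vec : is_vector_rep rho.
Variable Delta : U -> tensor U U.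
Hypothesis Delta_cop : is_coproduct Delta.
Variable p : U -> U -> K.
Hypothesis p_pair : is_pairing Delta p.
Variables (m : rlat n -> nat) (y x : forall mu : rlat n, 'I_(m mu) -> U).
Hypothesis yx_dual : forall mu, rlat_pos mu -> dual_bases p mu (@y mu) (@x mu).
Local Notation act := (actVV Delta rho).
Local Notation Th := (Theta rho y x).

Definition mx_deg (mu : rlat n) (M : 'M[K]_N) : Prop :=
  forall a b, M a b != 0 -> wt a = wt b + mu.

Lemma mx_deg_E c (a b : 'I_N) mu : wt a = wt b + mu -> mx_deg mu (c *: E K a b).
Proof.
move=> h a' b'; rewrite !mxE; case: (eqVneq a' a) => [->|_] /=; last by rewrite mulr0 eqxx.
by case: (eqVneq b' b) => [->|_] //=; rewrite mulr0 eqxx.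
Qed.

Lemma mx_deg_lin c mu M M' : mx_deg mu M -> mx_deg mu M' -> mx_deg mu (c *: M + M').
Proof.
move=> hM hM' a b; rewrite !mxE; have [Mab|/hM //] := eqVneq (M a b) 0.
by rewrite Mab mulr0 add0r => /hM'.
Qed.

Lemma gr_comp_mx_deg (I : Type) (g : I -> U) deg mu z :
  (forall i, mx_deg (deg i) (rho (g i))) -> gr_comp g deg mu z -> mx_deg mu (rho z).
Proof.
move=> g_deg; elim=> {mu z} [mu||i|mu c z z' _ IH _ IH'|mu nu z z' _ IH _ IH'] //.
- by move=> a b; rewrite rmorph0 mxE eqxx.
- move=> a b; rewrite rmorph1 -[1]/(1%:M) mxE addr0.
  by case: (eqVneq a b) => [->|_] //; rewrite mulr0n eqxx.
- by rewrite linearP; apply: mx_deg_lin.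
move=> a b; rewrite rmorphM -mulmxE mxE => h.
have [c] : exists c, rho z a c * rho z' c b != 0.
  apply/existsP; apply: contraNT h => /existsPn h0.
  by rewrite big1 // => c _; apply/eqP; have := h0 c; rewrite negbK.
rewrite mulf_eq0 negb_or => /andP[/IH -> /IH' ->].
by rewrite -addrA [nu + mu]addrC.
Qed.

Lemma wt_lo_hi (j : 'I_n) : wt (lo j) = wt (hi j) + alpha j.
Proof. by rewrite !wt_wtn loE hiE alpha_wtn addrC subrK. Qed.

Lemma wt_rev (k : 'I_N) : wt (rev_ord k) = - wt k.
Proof. by rewrite !wt_wtn rev_ordN wtn_rev // -ltnS. Qed.

Lemma wt_rev_hi_lo (j : 'I_n) : wt (rev_ord (hi j)) = wt (rev_ord (lo j)) + alpha j.
Proof. by rewrite !wt_rev wt_lo_hi opprD subrK. Qed.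

Lemma rho_e_deg j : mx_deg (alpha j) (rho (e j)).
Proof.
rewrite (vrep_e rho_vec) addrC -scaleN1r -[X in _ + X]scale1r.
by apply: mx_deg_lin; [rewrite -[E _ _ _]scale1r|]; apply: mx_deg_E;
  rewrite ?wt_lo_hi ?wt_rev_hi_lo.
Qed.

Lemma rho_f_deg j : mx_deg (- alpha j) (rho (f j)).
Proof.
have h1 : wt (hi j) = wt (lo j) - alpha j by rewrite wt_lo_hi addrK.
have h2 : wt (rev_ord (lo j)) = wt (rev_ord (hi j)) - alpha j.
  by rewrite wt_rev_hi_lo addrK.
case: (ltnP j.+1 n) => lt_j.
  rewrite (vrep_f rho_vec) // addrC -scaleNr -[X in _ + X]scale1r -[E _ (rev_ord _) _]scale1r.
  by apply: mx_deg_lin; apply: mx_deg_E.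
have e1 : j.+1 = n by have := ltn_ord j; lia.
rewrite (vrep_fn rho_vec) // scalerBr addrC -scaleNr.
have -> : E K (rev_ord (lo j)) (hi j) = E K (rev_ord (lo j)) (rev_ord (hi j)).
  by congr (E K _ _); apply/val_inj; rewrite /= subSS hiE e1 mul2n -addnn addnK.
rewrite -[X in X + _]addr0 -addrA -[E _ (rev_ord _) _]scale1r.
apply: mx_deg_lin; first exact: mx_deg_E.
by rewrite add0r; apply: mx_deg_E.
Qed.

Lemma Uplus_deg mu z : Uplus mu z -> mx_deg mu (rho z).
Proof. exact: gr_comp_mx_deg rho_e_deg. Qed.

Lemma Uminus_deg mu z : Uminus mu z -> mx_deg mu (rho z).
Proof. exact: gr_comp_mx_deg rho_f_deg. Qed.

(* The homogeneous component of Theta of arbitrary degree. *)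
Definition Theta_comp (mu : rlat n) : 'M[K]_(N * N) :=
  if mu == 0 then 1%:M
  else if `[< rlat_pos mu >] then Theta_mu rho (@y mu) (@x mu) else 0.

(** Degree 0 gets the dual bases {1} and {1}, and a degree outside the positive cone gets empty
    ones. The relation between degrees mu and mu - alpha_j thus holds for every mu, with no boundary
    cases. *)
Lemma Theta_comp_dual mu : exists m0 (y0 x0 : 'I_m0 -> U),
  dual_bases p mu y0 x0 /\ Theta_comp mu = Theta_mu rho y0 x0.
Proof.
rewrite /Theta_comp; case: (eqVneq mu 0) => [->|mu0].
  exists 1%N, (fun=> 1), (fun=> 1); split; last first.
    by rewrite /Theta_mu big_ord1 !rmorph1; apply/esym/tens11.
  split=> [||i j]; last by rewrite !ord1 eqxx (pair11 r_neq0 s_neq0 p_pair).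
    by rewrite /Uminus oppr0; apply: is_basis_unit => u; rewrite wdeg_opp => /eqP;
      rewrite oppr_eq0 => /eqP /wdeg_eq0.
  by apply: is_basis_unit => u; apply: wdeg_eq0.
case: asboolP => [mu_pos|mu_npos]; first by exists (m mu), (@y mu), (@x mu); split; auto.
have no_word u : wdeg (@alpha n) u <> mu.
  by move=> u_mu; apply: mu_npos; rewrite -u_mu; apply: wdeg_pos; rewrite u_mu.
exists 0%N, (fun=> 0), (fun=> 0); split; last by rewrite /Theta_mu big_ord0.
split=> [||[] //]; last exact: is_basis_empty.
by apply: is_basis_empty => u; rewrite wdeg_opp => /oppr_inj; apply: no_word.
Qed.

Lemma Theta_comp_deg mu (a b c d : 'I_N) :
  Theta_comp mu (mxtens_index (a, c)) (mxtens_index (b, d)) != 0 ->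
  wt a = wt b - mu /\ wt c = wt d + mu.
Proof.
have [m0 [y0 [x0 [D ->]]]] := Theta_comp_dual mu; have [ [y0_in _] [x0_in _] _] := D.
rewrite /Theta_mu summxE => h.
have [i i_neq0] : exists i : 'I_m0,
    (rho (y0 i) *t rho (x0 i)) (mxtens_index (a, c)) (mxtens_index (b, d)) != 0.
  apply/existsP; apply: contraNT h => /existsPn h0.
  by rewrite big1 // => i _; apply/eqP; have := h0 i; rewrite negbK.
move: i_neq0; rewrite tensmxE mulf_eq0 negb_or => /andP[h1 h2].
by split; [apply: Uminus_deg h1 | apply: Uplus_deg h2].
Qed.

(** The degrees in which an operator on V can be nonzero. Finiteness of this list makes the sum in
    [Theta] a genuine sum and not the default value 0. *)
Definition wt_diffs : seq (rlat n) :=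
  undup [seq wt a - wt b | a <- enum 'I_N, b <- enum 'I_N].

Lemma Theta_comp_support mu : mu \notin wt_diffs -> Theta_comp mu = 0.
Proof.
move=> mu_nin; apply/matrixP => i k; rewrite [RHS]mxE.
case: (mxtens_indexP i) => a c; case: (mxtens_indexP k) => b d.
apply/eqP; apply: contraNT mu_nin => /Theta_comp_deg[_ cd].
rewrite mem_undup; apply/allpairsP; exists (c, d); rewrite !mem_enum; split=> //=.
by rewrite cd addrC addKr.
Qed.

Lemma wt_diffs0 : 0 \in wt_diffs.
Proof.
by rewrite mem_undup; apply/allpairsP; exists (ord0, ord0); rewrite !mem_enum subrr.
Qed.

(** The list is left free so that Theta can be summed both over a list and over its translate by -
    alpha_j. *)
Lemma Theta_sum (l : seq (rlat n)) : uniq l -> {subset wt_diffs <= l} ->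
  Th = \sum_(mu <- l) Theta_comp mu.
Proof.
move=> l_uniq l_sub; have l0 : 0 \in l by apply: l_sub wt_diffs0.
have supp mu : mu \notin l -> Theta_comp mu = 0.
  by move=> mu_l; apply: Theta_comp_support; apply: contra mu_l => /l_sub.
rewrite (bigD1_seq 0) //= {1}/Theta_comp eqxx /Theta; congr (_ + _).
have -> : [set mu : rlat n | rlat_pos mu]%classic =
    [set` (fun mu : rlat n => `[< rlat_pos mu >])]%classic.
  by apply/seteqP; split=> mu /asboolP.
rewrite -(bigfs _ l_uniq) => [|mu /asboolP mu_pos mu_l].
  rewrite [RHS]big_mkcond [LHS]big_mkcond; apply: eq_bigr => mu _.
  rewrite /Theta_comp; case: eqVneq => [->|_] /=; last by case: asboolP.
  by case: asboolP => // -[/eqP].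
have := supp mu mu_l; rewrite /Theta_comp.
by case: eqVneq mu_pos => [->|_ mu_pos] => [[/eqP //]|]; case: asboolP.
Qed.

Lemma Theta_e j : (rho (e j) *t 1%:M + rho (w j) *t rho (e j)) *m Th =
  Th *m (rho (e j) *t 1%:M + rho (wp j) *t rho (e j)).
Proof.
(* Chosen so that l and its translate by - alpha_j both contain [wt_diffs]. The terms with e_j (x) 1
   are then taken in degree mu and those with e_j in the second factor in degree mu - alpha_j. *)
pose l := undup (wt_diffs ++ [seq mu + alpha j | mu <- wt_diffs]).
have l_uniq : uniq l by apply: undup_uniq.
have l_sub : {subset wt_diffs <= l} by move=> mu h; rewrite mem_undup mem_cat h.
have Th_l := Theta_sum l_uniq l_sub.
have Th_l' : Th = \sum_(mu <- l) Theta_comp (mu - alpha j).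
  rewrite (@Theta_sum [seq mu - alpha j | mu <- l]) ?big_map //.
    by rewrite map_inj_uniq //; apply: addIr.
  move=> mu h; apply/mapP; exists (mu + alpha j); last by rewrite addrK.
  by rewrite mem_undup mem_cat (map_f (fun nu => nu + alpha j)) ?orbT.
rewrite [LHS]mulmxDl [RHS]mulmxDr; apply/eqP; rewrite -subr_eq0 opprD addrACA.
rewrite {1 2}Th_l {1 2}Th_l' !mulmx_sumr !mulmx_suml -!sumrB -big_split big1 // => mu _ /=.
have [m0 [y0 [x0 [D0 ->]]]] := Theta_comp_dual mu.
have [m1 [y1 [x1 [D1 ->]]]] := Theta_comp_dual (mu - alpha j).
rewrite /Theta_mu (Theta_mu_e r_neq0 s_neq0 Delta_cop p_pair rho D0 D1).
by rewrite addrC -addrA [X in _ + X]addrA addNr add0r subrr.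
Qed.

(** v_k has height n - k, and a component of degree mu > 0 lowers the height of the first factor by
    [ht mu], so it strictly increases the first index. *)
Lemma Theta_upper (a b c d : 'I_N) : (a <= b)%N ->
  Th (mxtens_index (a, c)) (mxtens_index (b, d)) = ((a == b) && (c == d))%:R.
Proof.
move=> le_ab; rewrite (Theta_sum (undup_uniq _) (fun _ h => h)) summxE.
rewrite (bigD1_seq 0) ?wt_diffs0 ?undup_uniq //= big1 => [|mu mu0].
  rewrite {1}/Theta_comp eqxx mxE addr0 (can_eq (@mxtens_indexK _ _)) xpair_eqE.
  by [].
apply/eqP; apply/negPn/negP => h; have [ab _] := Theta_comp_deg h.
have mu_pos : rlat_pos mu.
  by move: h; rewrite /Theta_comp (negPf mu0); case: asboolP => // _; rewrite mxE eqxx.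
have := ht_pos mu_pos; move: (congr1 (@ht n) ab).
by rewrite !wt_wtn htD htN !ht_wtn ?ord_le //; lia.
Qed.

Lemma Theta_unit : Th \in unitmx.
Proof.
rewrite unitmxE det_trig.
  rewrite big1 ?unitr1 // => i _; case: (mxtens_indexP i) => a c.
  by rewrite Theta_upper // !eqxx.
apply/is_trig_mxP => i k; case: (mxtens_indexP i) => a c; case: (mxtens_indexP k) => b d /= lt_ik.
have le_ab : (a <= b)%N.
  (* [mxtens_index] orders pairs lexicographically, first factor leading. *)
  rewrite leqNgt; apply/negP => lt_ba; have := ltn_ord d; move: lt_ik lt_ba; nia.
rewrite Theta_upper //; case: eqVneq => [ab|] //=; case: eqVneq => [cd|] //=.
by move: lt_ik; rewrite ab cd ltnn.
Qed.

Definition diag_tens (c : nat -> nat -> K) : 'M[K]_(N * N) :=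
  \sum_(i < N) \sum_(j < N) c i j *: (E K i i *t E K j j).

Lemma diag_tens_bvv c (b d : 'I_N) : diag_tens c *m bvv b d = c b d *: bvv b d.
Proof.
rewrite /diag_tens mulmx_suml -[RHS](sum_delta xpredT b (fun i : 'I_N => c i d *: bvv i d)).
apply: eq_bigr => i _; rewrite mulmx_suml.
rewrite -[RHS](sum_delta xpredT d (fun j : 'I_N => (i == b)%:R *: (c i j *: bvv i j))).
apply: eq_bigr => j _; rewrite -scalemxAl EE_bvv !val_eqE !scalerA.
by congr (_ *: _); ring.
Qed.

Lemma ftilde_diag : ftilde r s n = diag_tens (fcoef r s n).
Proof.
rewrite /ftilde /diag_tens; apply: eq_bigr => i _; apply: eq_bigr => j _.
by rewrite /fwt !wt_wtn.
Qed.

Lemma tau_bvv (b d : 'I_N) : tau K n *m bvv b d = bvv d b.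
Proof.
rewrite /tau mulmx_suml -[RHS](sum_delta xpredT d (fun i : 'I_N => bvv i b)).
apply: eq_bigr => i _; rewrite mulmx_suml.
rewrite -[RHS](sum_delta xpredT b (fun j : 'I_N => (i == d)%:R *: bvv i j)).
by apply: eq_bigr => j _; rewrite EE_bvv !val_eqE scalerA.
Qed.

Lemma ftilde_tau_bvv b d : (b <= 2 * n)%N -> (d <= 2 * n)%N ->
  ftilde r s n *m tau K n *m bvv b d = fcoef r s n d b *: bvv d b.
Proof.
move=> le_b le_d; have lt_b : (b < N)%N by []; have lt_d : (d < N)%N by [].
rewrite -mulmxA (tau_bvv (Ordinal lt_b) (Ordinal lt_d)) ftilde_diag.
exact: (diag_tens_bvv _ (Ordinal lt_d) (Ordinal lt_b)).
Qed.

Lemma ftilde_tau_unit : ftilde r s n *m tau K n \in unitmx.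
Proof.
have tau_tau : tau K n *m tau K n = 1%:M.
  by apply: eq_mx_bvv => b d; rewrite -mulmxA !tau_bvv mul1mx.
have ff : ftilde r s n *m diag_tens (fun b d => (fcoef r s n b d)^-1) = 1%:M.
  apply: eq_mx_bvv => b d; rewrite -mulmxA diag_tens_bvv -scalemxAr ftilde_diag.
  by rewrite diag_tens_bvv scalerA mulVf ?scale1r ?mul1mx // invr_eq0 chiw_neq0.
by rewrite unitmx_mul (mulmx1_unit tau_tau).1 (mulmx1_unit ff).1.
Qed.

Local Notation Rvv := (R_VV rho y x).

Lemma R_unit : Rvv \in unitmx.
Proof. by rewrite /R_VV -mulmxA unitmx_mul Theta_unit ftilde_tau_unit. Qed.

(** The flip turns the coproduct of e_j into 1 (x) e_j + e_j (x) w_j. Conjugation by f~ multiplies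
    the first term by w'_j on the left factor and removes w_j from the second, since f(lambda, mu)
    is multiplicative in both weights. *)
Lemma ftilde_tau_e j : ftilde r s n *m tau K n *m act (e j) =
  (rho (e j) *t 1%:M + rho (wp j) *t rho (e j)) *m (ftilde r s n *m tau K n).
Proof.
have lt_j := ltn_ord j.
have := ftilde_tau_bvv; move: (ftilde r s n *m tau K n) => G G_bvv.
apply: eq_mx_bvv => b d; rewrite -!mulmxA [in RHS]G_bvv ?ord_le //.
rewrite (act_e_bvv r_neq0 s_neq0 rho_vec Delta_cop) mulmxDr -!scalemxAr.
rewrite !G_bvv ?(leq_trans (leq_pred _)) ?ord_le //.
rewrite mulmxDl !bvv_tens !(rho_e r_neq0 s_neq0 rho_vec) (rho_wp r_neq0 s_neq0 rho_vec) mul1mx.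
rewrite !tens_scale_l tens_scale_r !scalerDr !scalerA addrC; congr (_ *: _ + _ *: _).
  have [->|eps_d] := eqVneq (eps K n j d) 0; first by rewrite !(mulr0, mul0r).
  rewrite [RHS]mulrC (alpha_raise r_neq0 s_neq0 lt_j _ _ eps_d) ?ord_le //; ring.
have [->|eps_b] := eqVneq (eps K n j b) 0; first by rewrite !(mulr0, mul0r).
have [b_eq|b_eq] := eps_neq0 eps_b; rewrite b_eq /fcoef /wF /=.
  by field; rewrite !chiw_neq0 ?oner_neq0.
have -> : (2 * n - j).-1 = (2 * n - j.+1)%N by lia.
rewrite !(chiw_revl r_neq0 s_neq0); [|lia..].
by field; rewrite !chiw_neq0 ?oner_neq0.
Qed.

Lemma R_e j : Rvv *m act (e j) = act (e j) *m Rvv.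
Proof.
have -> : Rvv = Th *m (ftilde r s n *m tau K n) by rewrite /R_VV mulmxA.
have := ftilde_tau_e j; move: (ftilde r s n *m tau K n) => G Ge.
by rewrite -[LHS]mulmxA Ge [LHS]mulmxA -Theta_e -(act_e rho Delta_cop) [RHS]mulmxA.
Qed.

Lemma E_tr (i k : 'I_N) : (E K i k)^T = E K k i.
Proof. exact: trmx_delta. Qed.

(** Rows of an operator are columns of its transpose, and transposed e_j raises the index that e_j
    lowers. *)
Lemma rho_e_tr (j : 'I_n) a : (rho (e j))^T *m bv a = eps K n j a.+1 *: bv a.+1.
Proof.
have lt_j := ltn_ord j.
rewrite (vrep_e rho_vec) linearB /= !E_tr mulmxBl !E_bv !rev_ordN loE hiE /eps scalerBl.
rewrite eqSS; congr (_ - _); rewrite eq_sym; first by case: eqP => [->|_]; rewrite ?scale0r.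
have -> : (a == 2 * n - j.+1)%N = (a.+1 == 2 * n - j)%N by apply/eqP/eqP; lia.
by case: eqP => [->|_]; rewrite ?scale0r.
Qed.

Lemma rho_w_tr (j : 'I_n) a : (rho (w j))^T *m bv a = wE r s n j a *: bv a.
Proof.
case: (ltnP a N) => [lt_a|le_a]; last by rewrite bv_out // mulmx0 scaler0.
have w_diag i (k : 'I_N) : rho (w j) i k = wE r s n j k * (i == k)%:R.
  transitivity ((rho (w j) *m bv k) i 0).
    rewrite mxE (bigD1 k) //= big1 => [|l ne]; first by rewrite mxE eqxx mulr1 addr0.
    by rewrite mxE val_eqE (negPf ne) mulr0.
  by rewrite (rho_w r_neq0 s_neq0 rho_vec) !mxE val_eqE.
apply/colP => i; rewrite mxE (bigD1 (Ordinal lt_a)) //= big1 => [|l ne].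
  rewrite !mxE eqxx mulr1 addr0 w_diag -val_eqE /= [i == a :> nat]eq_sym.
  by case: eqP => [->|]; rewrite ?mulr0.
by rewrite !mxE (_ : l == a :> nat = false) ?mulr0 //; apply/negbTE; rewrite -val_eqE in ne.
Qed.

Lemma act_e_tr (j : 'I_n) a c : (act (e j))^T *m bvv a c =
  eps K n j a.+1 *: bvv a.+1 c + (wE r s n j a * eps K n j c.+1) *: bvv a c.+1.
Proof.
rewrite (act_e rho Delta_cop) linearD /= !trmx_tens trmx1 mulmxDl !bvv_tens mul1mx.
by rewrite !rho_e_tr rho_w_tr !tens_scale_l tens_scale_r scalerA.
Qed.

(* Commuting with the action of the e_j, the operator is determined by its
   rows of index (1, c): the e_j move row (a, c) to row (a + 1, c), up to rows
   of first index a. *)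
Lemma eq_intertwiner (A B : 'M[K]_(N * N)) :
  (forall j, A *m act (e j) = act (e j) *m A) ->
  (forall j, B *m act (e j) = act (e j) *m B) ->
  (forall c b d : 'I_N, A (mxtens_index (ord0, c)) (mxtens_index (b, d)) =
                        B (mxtens_index (ord0, c)) (mxtens_index (b, d))) ->
  A = B.
Proof.
move=> A_e B_e AB0; apply/eqP; rewrite -subr_eq0; apply/eqP.
apply: trmx_inj; rewrite trmx0; set X := (A - B)^T.
have X_e j : (act (e j))^T *m X = X *m (act (e j))^T.
  by rewrite -!trmx_mul mulmxBl mulmxBr A_e B_e.
suff X0 a : (a <= 2 * n)%N -> forall c, X *m bvv a c = 0.
  by apply: eq_mx_bvv => b d; rewrite mul0mx X0 ?ord_le.
elim: a => [_ c|a IH lt_a c].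
  case: (ltnP c N) => [lt_c|le_c]; last by rewrite /bvv (bv_out K le_c) tensmx0 mulmx0.
  apply/matrixP => k i; rewrite [RHS]mxE (ord1 i).
  rewrite (mulmx_bvv X ord0 (Ordinal lt_c)) !mxE; case: (mxtens_indexP k) => b d.
  by rewrite AB0 subrr.
(* Any two neighbouring basis vectors are linked by some e_j: j = a in the first half, and the
   mirror image j = 2n - a - 1 in the second. *)
have [j eps_neq0] : exists j : 'I_n, eps K n j a.+1 != 0.
  case: (ltnP a n) => lt_an.
    exists (Ordinal lt_an); rewrite /eps eqxx (_ : a.+1 == 2 * n - a = false)%N
      ?subr0 ?oner_eq0 //=.
    by apply/eqP; lia.
  have lt_j : (2 * n - a.+1 < n)%N by lia.
  exists (Ordinal lt_j); rewrite /eps /= subKn // eqxx (_ : a.+1 == (2 * n - a.+1).+1 = false)%N.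
    by rewrite sub0r oppr_eq0 oner_eq0.
  by apply/eqP; lia.
have /eqP : eps K n j a.+1 *: (X *m bvv a.+1 c) = 0.
  (* On v_a (x) v_c the induction hypothesis kills the left side and every term of first index a,
     leaving only the one of first index a + 1. *)
  have := congr1 (mulmx^~ (bvv a c)) (X_e j).
  rewrite -!mulmxA IH ?(ltnW lt_a) // mulmx0 act_e_tr mulmxDr -!scalemxAr.
  by rewrite IH ?(ltnW lt_a) // scaler0 addr0.
by rewrite scaler_eq0 (negPf eps_neq0) => /eqP.
Qed.

Lemma R_row0 (c b d : 'I_N) : Rvv (mxtens_index (ord0, c)) (mxtens_index (b, d)) =
  fcoef r s n d b * ((ord0 == d) && (c == b))%:R.
Proof.
rewrite -(mulmx_bvv _ _ _ _ ord0) /R_VV -!mulmxA [ftilde _ _ _ *m _]mulmxA.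
rewrite ftilde_tau_bvv ?ord_le // -scalemxAr mxE mulmx_bvv.
by rewrite Theta_upper.
Qed.

(** Two of the three terms of [braid_vec] never reach first index 0: v_b (x) v_d does so only for b
    = 0, where [d < b] is zero, and the truncated sum has first indices 2n - i with i < b <= 2n. *)
Lemma Rhat_row0 (c b d : 'I_N) :
  Rhat r s n (mxtens_index (ord0, c)) (mxtens_index (b, d)) =
  fcoef r s n d b * ((ord0 == d) && (c == b))%:R.
Proof.
rewrite -(mulmx_bvv _ _ _ _ ord0) (Rhat_braid r_neq0 s_neq0) ?ord_le //.
have entries (M1 M2 M3 : 'M[K]_(N * N, 1 * 1)) c1 c2 c3 k i :
  (c1 *: M1 - c2 *: M2 + c3 *: M3) k i = c1 * M1 k i - c2 * M2 k i + c3 * M3 k i.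
  by rewrite !mxE.
rewrite /braid_vec entries !bvvE !val_eqE -natrM mulnb.
rewrite [X in _ - X](_ : _ = 0); last first.
  by case: (eqVneq ord0 b) => [<-|_]; rewrite ?(mulr0, mul0r).
rewrite [X in _ + _ * X](_ : _ = 0) ?mulr0 ?subr0 ?addr0 //.
rewrite /braid_sum summxE big1 // => i _; rewrite mxE bvvE.
rewrite (_ : (ord0 : 'I_N) == 2 * n - i :> nat = false)%N ?mul0r ?mulr0 //.
by apply/eqP => /=; have := ltn_ord i; have := ord_le b; lia.
Qed.

Lemma R_VV_Rhat : Rvv = Rhat r s n.
Proof.
apply: eq_intertwiner => [|j|c b d]; first exact: R_e.
  exact: (Rhat_act r_neq0 s_neq0 rho_vec Delta_cop).
by rewrite R_row0 Rhat_row0.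
Qed.

End Main.

Lemma indeterminates_neq0 (R : realType) (K : fieldType) (iota : {rmorphism Crs R -> K}) :
  iota (r_ind R) != 0 /\ iota (s_ind R) != 0.
Proof.
rewrite !fmorph_eq0 /r_ind /s_ind !tofrac_eq0 polyX_eq0 polyC_eq0 polyX_eq0.
by [].
Qed.

Theorem theorem4p4 (R : realType) (K : closedFieldType)
    (iota : {rmorphism Crs R -> K}) (n : nat) (n_gt0 : (0 < n)%N) :
  let r := iota (r_ind R) in
  let s := iota (s_ind R) in
  forall (Delta : U r s n -> tensor (U r s n) (U r s n))
    (p : U r s n -> U r s n -> K)
    (m : rlat n -> nat)
    (y x : forall mu : rlat n, 'I_(m mu) -> U r s n)
    (rho : {lrmorphism U r s n -> 'M[K]_((2 * n).+1)}),
  is_coproduct Delta ->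
  is_pairing Delta p ->
  (forall mu, rlat_pos mu -> dual_bases p mu (y mu) (x mu)) ->
  is_vector_rep rho ->
  [/\ forall u, R_VV rho y x *m actVV Delta rho u = actVV Delta rho u *m R_VV rho y x,
      R_VV rho y x \in unitmx
    & R_VV rho y x = Rhat r s n].
Proof.
move=> r s Delta p m y x rho Delta_cop p_pair yx_dual rho_vec.
have [r_neq0 s_neq0] := indeterminates_neq0 iota.
have R_unit := R_unit r_neq0 s_neq0 rho_vec p_pair yx_dual.
have RE := R_VV_Rhat r_neq0 s_neq0 rho_vec Delta_cop p_pair yx_dual.
split=> // u; rewrite RE.
exact: (Rhat_act r_neq0 s_neq0 rho_vec Delta_cop).
Qed.
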